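(* Let $P\subseteq\mathbb{R}^n$ be a rational polyhedron. For all integers $k\ge 0$, $$\mathcal{S}^{2k}(P)\subseteq \mathcal{T}^k(P)\subseteq \mathcal{S}^k(P).$$ Consequently, $$\tfrac12\,\mathrm{rank}_{\mathcal{S}}(P)\le \mathrm{rank}_{\mathcal{T}}(P)\le \mathrm{rank}_{\mathcal{S}}(P).$$
   Context: For a set $Q\subseteq\mathbb{R}^n$, write $Q_I := \operatorname{conv}(Q\cap\mathbb{Z}^n)$. A rational halfspace is a set $\{x\in\mathbb{R}^n:\langle a,x\rangle\le \beta\}$ with $a\in\mathbb{Q}^n\setminus\{0\}$, $\beta\in\mathbb{Q}$. The two-halfspace closure of a polyhedron $P\subseteq\mathbb{R}^n$ is $$\mathcal{T}(P)=\bigcap_{\substack{H_1,H_2 \text{ rational halfspaces}\\ \text{such that } P\subseteq H_1\cap H_2}}(H_1\cap H_2)_I ,$$ where an intersection over an empty index set is $\mathbb{R}^n$. For $a\in\mathbb{Z}^n$ and $K\in\mathbb{Z}$ let $D_{a,K}=\{x\in\mathbb{R}^n:\langle a,x\rangle\le K\}\cup\{x\in\mathbb{R}^n:\langle a,x\rangle\ge K+1\}$ and $P^{a,K}:=\operatorname{conv}(P\cap D_{a,K})$. The split closure of $P$ is $$\mathcal{S}(P):=\bigcap_{a\in\mathbb{Z}^n,\,K\in\mathbb{Z}}P^{a,K}.$$ Both closures of a rational polyhedron are rational polyhedra, and they are iterated: $\mathcal{T}^0(P)=\mathcal{S}^0(P)=P$, $\mathcal{T}^k(P)=\mathcal{T}(\mathcal{T}^{k-1}(P))$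 and $\mathcal{S}^k(P)=\mathcal{S}(\mathcal{S}^{k-1}(P))$ for $k\ge1$. $\mathrm{rank}_{\mathcal{T}}(P)$ is the smallest $k\in\mathbb{N}$ (with $0$ allowed) such that $\mathcal{T}^k(P)=P_I$, and $\mathrm{rank}_{\mathcal{S}}(P)$ is the smallest $k\in\mathbb{N}$ such that $\mathcal{S}^k(P)=P_I$; both are finite for rational polyhedra. *)

(* Defs.v *)
From HB Require Import structures.
From mathcomp Require Import all_boot all_order all_algebra.
From mathcomp Require Import all_classical all_reals all_analysis.

Set Implicit Arguments.
Unset Strict Implicit.
Unset Printing Implicit Defensive.

Import Order.TTheory GRing.Theory Num.Theory.

Local Open Scope classical_set_scope.
Local Open Scope ring_scope.

Section Closures.
Context {R : realType} {n : nat}.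
Implicit Types (P Q H : set 'rV[R]_n) (cl : set 'rV[R]_n -> set 'rV[R]_n).

Definition inner (a x : 'rV[R]_n) : R := \sum_(j < n) a 0 j * x 0 j.

Definition halfspace (a : 'rV[R]_n) (beta : R) : set 'rV[R]_n :=
  [set x | inner a x <= beta].

Definition rational_halfspace H : Prop :=
  exists (a : 'rV[rat]_n) (beta : rat),
    a != 0 /\ H = halfspace (map_mx ratr a) (ratr beta).

(* The number m of inequalities may be 0, and rows of A may be 0. *)
Definition rational_polyhedron P : Prop :=
  exists (m : nat) (A : 'M[rat]_(m, n)) (b : 'I_m -> rat),
    P = [set x | forall i, inner (map_mx ratr (row i A)) x <= ratr (b i)].

Definition convex_hull Q : set 'rV[R]_n := smallest (@convex_set R 'rV[R]_n) Q.

Definition integer_hull Q : set 'rV[R]_n :=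
  convex_hull (Q `&` [set x | x \is a mxOver Num.int]).

Definition two_halfspace_closure P : set 'rV[R]_n :=
  [set x | forall H1 H2, rational_halfspace H1 -> rational_halfspace H2 ->
    P `<=` H1 `&` H2 -> integer_hull (H1 `&` H2) x].

Definition split_disjunction (a : 'rV[int]_n) (K : int) : set 'rV[R]_n :=
  [set x | inner (map_mx intr a) x <= K%:~R] `|`
  [set x | inner (map_mx intr a) x >= (K + 1)%:~R].

Definition split_closure P : set 'rV[R]_n :=
  [set x | forall (a : 'rV[int]_n) (K : int),
    convex_hull (P `&` split_disjunction a K) x].

(* The least k such that cl^k(P) = P_I, and +oo if there is no such k. *)
Definition closure_rank cl P : \bar R :=
  if pselect (exists k, `[< iter k cl P = integer_hull P >]) is left ex
  then (ex_minn ex)%:R%:E else +oo%E.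

End Closures.

(* Main.v *)
Require Import Defs.
From HB Require Import structures.
From mathcomp Require Import all_boot all_order all_algebra.
From mathcomp Require Import all_classical all_reals all_analysis.
From mathcomp Require Import ring lra zify.

Set Implicit Arguments.
Unset Strict Implicit.
Unset Printing Implicit Defensive.

Import Order.TTheory GRing.Theory Num.Theory numFieldNormedType.Exports.
Local Open Scope classical_set_scope.
Local Open Scope ring_scope.

(* Both closures are monotone, so each inclusion reduces to one step.

   [S (S X)] is contained in [T X] for every set [X]: it suffices that an
   intersection of two rational halfspaces has split rank at most 2.  In
   suitable lattice coordinates such a wedge is the region under a line, its
   integer hull lies under the upper hull of the quasi-periodic sequence of
   integer parts of that line, and every edge of this upper hull is cut out by
   two successive splits.

   [T X] is contained in [S X] for a rational polyhedron [X] by linear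
   programming duality: an inequality valid for both sides of a split is implied
   there by two rational inequalities valid for [X].  To iterate this without
   showing that [S X] is polyhedral, it is extended to the sets that are
   intersections of rational polyhedra retaining the lineality space of the
   initial polyhedron; compactness shows that this class is stable under [S]. *)

(** * Inner products and convex hulls *)

Section Inner.
Context {R : realType} {n : nat}.
Implicit Types (a b x y : 'rV[R]_n) (t : R).

Lemma innerC a x : inner a x = inner x a.
Proof. by apply: eq_bigr => j _; rewrite mulrC. Qed.

Lemma innerDr a x y : inner a (x + y) = inner a x + inner a y.
Proof. by rewrite -big_split; apply: eq_bigr => j _; rewrite mxE mulrDr. Qed.

Lemma innerZr a t x : inner a (t *: x) = t * inner a x.
Proof. by rewrite mulr_sumr; apply: eq_bigr => j _; rewrite mxE mulrCA. Qed.

Lemma innerNr a x : inner a (- x) = - inner a x.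
Proof. by rewrite -scaleN1r innerZr mulN1r. Qed.

Lemma innerBr a x y : inner a (x - y) = inner a x - inner a y.
Proof. by rewrite innerDr innerNr. Qed.

Lemma innerDl a b x : inner (a + b) x = inner a x + inner b x.
Proof. by rewrite !(innerC _ x) innerDr. Qed.

Lemma innerZl a t x : inner (t *: a) x = t * inner a x.
Proof. by rewrite !(innerC _ x) innerZr. Qed.

Lemma innerNl a x : inner (- a) x = - inner a x.
Proof. by rewrite !(innerC _ x) innerNr. Qed.

Lemma inner0l x : inner 0 x = 0.
Proof. by rewrite -(scale0r (0 : 'rV[R]_n)) innerZl mul0r. Qed.

Lemma inner_suml (I : finType) (F : I -> 'rV[R]_n) x :
  inner (\sum_i F i) x = \sum_i inner (F i) x.
Proof.
apply: (big_morph (fun a => inner a x)) => [a b|]; first exact: innerDl.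
exact: inner0l.
Qed.

End Inner.

Definition innerE := (@innerDr, @innerBr, @innerDl, @innerZr, @innerZl, @innerNr, @innerNl).

Section Hull.
Context {R : realType} {n : nat}.
Implicit Types (A P Q : set 'rV[R]_n) (x y r : 'rV[R]_n).

Lemma convex_setP A : @convex_set R 'rV[R]_n A <->
  (forall x y (t : R), A x -> A y -> 0 <= t -> t <= 1 -> A (t *: x + (1 - t) *: y)).
Proof.
split=> [cA x y t Ax Ay t0 t1|cA x y t].
  have := cA x y (Itv01 t0 t1); rewrite !inE => /(_ Ax Ay).
  by [].
rewrite !inE => Ax Ay.
exact: cA.
Qed.

Lemma hull_convex Q x y (t : R) : convex_hull Q x -> convex_hull Q y ->
  0 <= t -> t <= 1 -> convex_hull Q (t *: x + (1 - t) *: y).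
Proof.
move=> Qx Qy t0 t1 A [cA QA].
by move/convex_setP: (cA); apply => //; [exact: Qx|exact: Qy].
Qed.

Lemma convex_hull_convex Q : @convex_set R 'rV[R]_n (convex_hull Q).
Proof. by apply/convex_setP => x y t; exact: hull_convex. Qed.

Lemma sub_hull Q : Q `<=` convex_hull Q.
Proof. exact: sub_gen_smallest. Qed.

Lemma hull_min Q A : @convex_set R 'rV[R]_n A -> Q `<=` A -> convex_hull Q `<=` A.
Proof. exact: smallest_sub. Qed.

Lemma hull_mono P Q : P `<=` Q -> convex_hull P `<=` convex_hull Q.
Proof.
move=> PQ; apply: hull_min; first exact: convex_hull_convex.
exact: subset_trans PQ (@sub_hull Q).
Qed.

Lemma convex_setI P Q : @convex_set R 'rV[R]_n P -> @convex_set R 'rV[R]_n Q ->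
  @convex_set R 'rV[R]_n (P `&` Q).
Proof.
move=> /convex_setP cP /convex_setP cQ; apply/convex_setP => x y t [x1 x2] [y1 y2] t0 t1.
by split; [exact: cP|exact: cQ].
Qed.

Lemma halfspace_convex (a : 'rV[R]_n) (b : R) :
  @convex_set R 'rV[R]_n (halfspace a b).
Proof.
apply/convex_setP => x y t; rewrite /halfspace /= => hx hy t0 t1.
rewrite !innerE; nra.
Qed.

(** The weights are [t / (s + t)] and [s / (s + t)]; if [s + t = 0], both points are [x] itself. *)
Lemma hull_between Q x r (s t : R) : 0 <= s -> 0 <= t ->
  convex_hull Q (x - s *: r) -> convex_hull Q (x + t *: r) -> convex_hull Q x.
Proof.
move=> s0 t0 h1 h2.
have [st|st] := eqVneq (s + t) 0.
  have -> : x = x + t *: r; last by [].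
  have -> : t = 0 by lra.
  by rewrite scale0r addr0.
have := hull_convex h1 h2 (t := t / (s + t)).
have stp : 0 < s + t by rewrite lt0r st addr_ge0.
rewrite divr_ge0 ?addr_ge0// ler_pdivrMr// mul1r lerDr => /(_ isT s0).
congr (convex_hull _ _); rewrite !scalerDr scalerN !scalerA addrACA -scalerDl.
have -> : t / (s + t) + (1 - t / (s + t)) = 1 by ring.
have -> : (1 - t / (s + t)) * t = t / (s + t) * s by field.
by rewrite scale1r addNr addr0.
Qed.

Lemma hull_translate Q r : (forall z, Q z -> convex_hull Q (z + r)) ->
  forall x, convex_hull Q x -> convex_hull Q (x + r).
Proof.
move=> Qr; apply: (@hull_min Q [set x | convex_hull Q (x + r)]) => //.
apply/convex_setP => x y t /= hx hy t0 t1.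
have := hull_convex hx hy t0 t1; congr (convex_hull _ _).
by rewrite !scalerDr addrACA -scalerDl addrCA subrr addr0 scale1r.
Qed.

End Hull.

(** * Two splits per edge of the integer hull *)

Section Split.
Context {R : realType} {n : nat}.
Implicit Types (C P Q X : set 'rV[R]_n) (x y z p q : 'rV[R]_n).
Local Notation intv a := (map_mx intr a : 'rV[R]_n).

Lemma segment_level C (a x y : 'rV[R]_n) (v : R) :
  @convex_set R 'rV[R]_n C -> C x -> C y -> inner a x <= v -> v <= inner a y ->
  exists t : R, [/\ 0 <= t, t <= 1, C (t *: x + (1 - t) *: y) &
    inner a (t *: x + (1 - t) *: y) = v].
Proof.
move=> /convex_setP cC Cx Cy xv vy.
have [e|ne] := eqVneq (inner a x) (inner a y).
  exists 1; split=> //; first exact: cC.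
  by rewrite !innerE; lra.
have lt : 0 < inner a y - inner a x.
  by rewrite subr_gt0 lt_neqAle ne (le_trans xv).
have t0 : 0 <= (inner a y - v) / (inner a y - inner a x).
  by apply: divr_ge0; lra.
have t1 : (inner a y - v) / (inner a y - inner a x) <= 1.
  by rewrite ler_pdivrMr//; lra.
exists ((inner a y - v) / (inner a y - inner a x)); split=> //; first exact: cC.
by rewrite !innerE; field; lra.
Qed.

Lemma split_closure_mono P Q : P `<=` Q -> split_closure P `<=` split_closure Q.
Proof.
move=> PQ x Px a K; apply: hull_mono (Px a K) => y [Py Dy].
by split=> //; exact: PQ.
Qed.

Lemma split_closure_sub P : @convex_set R 'rV[R]_n P -> split_closure P `<=` P.
Proof.
move=> cP x /(_ 0 0); apply: hull_min => //.
Qed.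

Lemma hull_split_sub X (A : set 'rV[R]_n) (a : 'rV[int]_n) (K : int) :
  @convex_set R 'rV[R]_n A ->
  (forall z, X z -> inner (intv a) z <= K%:~R -> A z) ->
  (forall z, X z -> (K + 1)%:~R <= inner (intv a) z -> A z) ->
  split_closure X `<=` A.
Proof.
move=> cA h1 h2 x /(_ a K); apply: hull_min => // z [Xz [] /= hz].
  exact: h1.
exact: h2.
Qed.

(** The upper side of this split misses [X], so the split acts as a rounding cut. *)
Lemma split_closure_cut X (c : 'rV[int]_n) (d : int) :
  (forall z, X z -> inner (intv c) z < (d + 1)%:~R) ->
  split_closure X `<=` halfspace (intv c) d%:~R.
Proof.
move=> Xc; apply: (hull_split_sub (a := c) (K := d)) => //.
  exact: halfspace_convex.
by move=> z /Xc h1 h2; move: h2; rewrite leNgt h1.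
Qed.

(** The first of two successive splits only yields a strict bound, which the second one rounds. *)
Lemma open_halfspace_convex (a : 'rV[R]_n) (b : R) :
  @convex_set R 'rV[R]_n [set z | inner a z < b].
Proof.
apply/convex_setP => x y t /= hx hy t0 t1; rewrite !innerE.
have [->|tp] := eqVneq t 0; first lra.
have {t0 tp} : 0 < t by rewrite lt0r tp.
nra.
Qed.

(* The slice of [C] at level [d + 1] of [c] lies strictly between two
   consecutive integer levels of [b]; shearing [b] by a multiple of [c] aligns
   them with the levels of [p] and [q].  The split along the sheared [b] then
   cuts [C] strictly below level [d + 1], and the split along [c] finishes. *)
Lemma split_closure_twice_cut C (b c : 'rV[int]_n) (d e : int) p q :
  @convex_set R 'rV[R]_n C -> C p -> C q ->
  inner (intv c) p = d%:~R -> inner (intv c) q = d%:~R ->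
  inner (intv b) p = e%:~R -> inner (intv b) q = (e + 1)%:~R ->
  (forall z (k : int), C z -> inner (intv c) z = (d + 1)%:~R ->
     inner (intv b) z <> k%:~R) ->
  split_closure (split_closure C) `<=` halfspace (intv c) d%:~R.
Proof.
move=> cC Cp Cq cp cq bp bq nolat.
apply: split_closure_cut.
have [[z0 [Cz0 cz0]]|none] := pselect (exists z, C z /\ inner (intv c) z = (d + 1)%:~R);
  last first.
  move=> z /(split_closure_sub cC) Cz; rewrite ltNge; apply/negP => cz.
  have [|t [t0 t1 Cw cw]] := segment_level cC Cp Cz _ cz.
    by rewrite cp ler_int; lia.
  by apply: none; eexists; split; [exact: Cw|].
pose k := Num.floor (inner (intv b) z0).
have /andP[kz0 z0k] := floor_itv (inner (intv b) z0); rewrite -/k in kz0 z0k.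
(* If [b] left the open interval on the slice, the segment to [z0] would meet an integer value of
   [b] within the slice. *)
have strip z : C z -> inner (intv c) z = (d + 1)%:~R ->
    k%:~R < inner (intv b) z < (k + 1)%:~R.
  move=> Cz cz; apply/andP; split; rewrite ltNge; apply/negP => bz.
    have [t [t0 t1 Cw bw]] := segment_level cC Cz Cz0 bz kz0.
    apply: (nolat _ k Cw _ bw).
    by rewrite !innerDr !innerZr cz cz0; ring.
  have [t [t0 t1 Cw bw]] := segment_level cC Cz0 Cz (ltW z0k) bz.
  apply: (nolat _ (k + 1) Cw _ bw).
  by rewrite !innerDr !innerZr cz cz0; ring.
(* With this shear [b'] equals [e + l * d] both at [p] and on the lower boundary of the strip at
   level [d + 1], and one more both at [q] and on the upper boundary. *)
pose l := e - k.
pose b' := b + l *: c.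
have b'E z : inner (intv b') z = inner (intv b) z + l%:~R * inner (intv c) z.
  by rewrite map_mxD map_mxZ innerDl innerZl.
have lR : l%:~R = e%:~R - k%:~R :> R by rewrite rmorphB.
have kd1 m : (m + 1)%:~R = m%:~R + 1 :> R by rewrite rmorphD.
have kE : (e + l * d)%:~R = e%:~R + l%:~R * d%:~R :> R by rewrite rmorphD rmorphM.
apply: (hull_split_sub (a := b') (K := e + l * d)).
- exact: open_halfspace_convex.
(* On the lower side, a point at or above level [d + 1] is joined to [p]: the segment crosses that
   level outside the strip. On the upper side [q] plays the role of [p]. *)
- move=> z Cz bz /=; rewrite ltNge; apply/negP => cz.
  have [|t [t0 t1 Cw cw]] := segment_level cC Cp Cz _ cz.
    by rewrite cp ler_int; lia.
  have /andP[+ _] := strip _ Cw cw.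
  have : inner (intv b') (t *: p + (1 - t) *: z) <= (e + l * d)%:~R.
    rewrite innerDr !innerZr {1}b'E bp cp -kE; nra.
  rewrite b'E cw kE !kd1 lR; nra.
- move=> z Cz bz /=; rewrite ltNge; apply/negP => cz.
  have [|t [t0 t1 Cw cw]] := segment_level cC Cq Cz _ cz.
    by rewrite cq ler_int; lia.
  have /andP[_] := strip _ Cw cw.
  have : (e + l * d + 1)%:~R <= inner (intv b') (t *: q + (1 - t) *: z).
    rewrite innerDr !innerZr {1}b'E bq cq.
    have -> : (e + 1)%:~R + l%:~R * d%:~R = (e + l * d + 1)%:~R :> R.
      by rewrite !kd1 kE; ring.
    nra.
  rewrite b'E cw !kd1 kE lR; nra.
Qed.

End Split.

(** * Upper hulls of quasi-periodic integer sequences *)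

Section GiftWrapping.

(** The best slope among the [d] indices following [i] is best overall: it is at least the slope
    [h / d] of a full period, so adding periods to [k] cannot beat it. *)
Lemma slope_argmax (g : nat -> int) (d : nat) (h : int) (i : nat) :
  (0 < d)%N -> (forall k, g (k + d)%N = g k + h) ->
  exists2 j, (i < j)%N &
    forall k, (i < k)%N -> (g k - g i) * (j%:Z - i%:Z) <= (g j - g i) * (k%:Z - i%:Z).
Proof.
move=> d0 gd.
pose s (r : 'I_d) : rat := (g (i + r.+1)%N - g i)%:~R / (r.+1)%:R.
have [r _ rmax] := @arg_maxP _ rat 'I_d (Ordinal d0) xpredT s isT.
exists (i + r.+1)%N; first by rewrite addnS ltnS leq_addr.
have base (r' : 'I_d) :
    (g (i + r'.+1)%N - g i) * r.+1%:Z <= (g (i + r.+1)%N - g i) * r'.+1%:Z.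
  have := rmax r' isT; rewrite /s.
  rewrite /= ler_pdivrMr ?ltr0n// mulrAC ler_pdivlMr ?ltr0n//.
  by rewrite !pmulrn -!rmorphM/= ler_int.
have dle : h * r.+1%:Z <= (g (i + r.+1)%N - g i) * d%:Z.
  have dd : (d.-1 < d)%N by rewrite prednK.
  have := base (Ordinal dd); rewrite /= prednK// gd; lia.
move=> k; elim/ltn_ind: k => k IH ik.
have [kd|kd] := leqP k (i + d).
  have kk : (k - i.+1 < d)%N by lia.
  have := base (Ordinal kk) => /=.
  have -> : (i + (k - i.+1).+1 = k)%N by lia.
  have -> : (k - i.+1).+1%:Z = k%:Z - i%:Z by lia.
  by have -> : (i + r.+1)%:Z - i%:Z = r.+1%:Z by lia.
have {}IH : (g (k - d)%N - g i) * ((i + r.+1)%:Z - i%:Z)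
  <= (g (i + r.+1)%N - g i) * ((k - d)%:Z - i%:Z) by apply: IH; lia.
have := gd (k - d)%N; have -> : (k - d + d = k)%N by lia.
move=> ->; move: IH.
have -> : (i + r.+1)%:Z - i%:Z = r.+1%:Z by lia.
have -> : (k - d)%:Z = k%:Z - d%:Z by lia.
nia.
Qed.

(* Gift wrapping: each new vertex maximizes the slope from the previous one, so
   slopes decrease and the line through the new edge still dominates [g] on the
   left of that edge. *)
Lemma upper_hull_edge (g : nat -> int) (d : nat) (h : int) (m : nat) :
  (0 < d)%N -> (forall k, g (k + d)%N = g k + h) ->
  exists i j, [/\ (i <= m)%N, (m < j)%N &
    forall k, (g k - g i) * (j%:Z - i%:Z) <= (g j - g i) * (k%:Z - i%:Z)].
Proof.
move=> d0 gd; elim: m => [|m [i [j [im mj ij]]]].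
  have [j j0 jmax] := slope_argmax 0 d0 gd.
  exists 0%N, j; split=> // -[|k]; last exact: jmax.
  by rewrite !subrr mul0r mulr0.
have [mj'|jm] := ltnP m.+1 j; first by exists i, j; split=> //; lia.
have {jm mj} jE : j = m.+1 by lia.
have [j' j'm jmax] := slope_argmax m.+1 d0 gd.
exists m.+1, j'; split=> // k.
have [mk|km] := ltnP m.+1 k; first exact: jmax.
have := ij j'; have := ij k; rewrite jE => hk hj'.
have p1 : 0 < m.+1%:Z - i%:Z by lia.
have p2 : 0 < j'%:Z - m.+1%:Z by lia.
have p3 : 0 <= m.+1%:Z - k%:Z by lia.
set D := m.+1%:Z - i%:Z in p1 hk hj' *.
rewrite -(ler_pM2l p1).
have slope : (g j' - g m.+1) * D <= (g m.+1 - g i) * (j'%:Z - m.+1%:Z) by lia.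
have left : (g k - g m.+1) * D <= (g m.+1 - g i) * (k%:Z - m.+1%:Z) by lia.
nia.
Qed.

End GiftWrapping.

(** * Wedges and lattice coordinates *)

Section Bezout.
Context {n : nat}.
Implicit Types (v u : 'rV[int]_n).

Definition dot v u : int := \sum_(j < n) v 0 j * u 0 j.

Lemma dotDr v u u' : dot v (u + u') = dot v u + dot v u'.
Proof. by rewrite -big_split; apply: eq_bigr => j _; rewrite mxE mulrDr. Qed.

Lemma dotZr v k u : dot v (k *: u) = k * dot v u.
Proof. by rewrite mulr_sumr; apply: eq_bigr => j _; rewrite mxE mulrCA. Qed.

Lemma dotC v u : dot v u = dot u v.
Proof. by apply: eq_bigr => j _; rewrite mulrC. Qed.

Lemma dotBr v u u' : dot v (u - u') = dot v u - dot v u'.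
Proof. by rewrite dotDr -scaleN1r dotZr mulN1r. Qed.

Lemma dotBl v v' u : dot (v - v') u = dot v u - dot v' u.
Proof. by rewrite !(dotC _ u) dotBr. Qed.

Lemma dotZl v k u : dot (k *: v) u = k * dot v u.
Proof. by rewrite !(dotC _ u) dotZr. Qed.

Lemma dot_delta v j : dot v (delta_mx 0 j) = v 0 j.
Proof.
rewrite /dot (bigD1 j)//= mxE !eqxx mulr1 big1 ?addr0// => i ij.
by rewrite mxE (negbTE ij) andbF mulr0.
Qed.

(** The least positive value [g] of [dot v] divides every entry of [v], since a nonzero remainder
    would be a smaller positive value. *)
Lemma primitive_vector v : v != 0 ->
  exists (g : nat) v' u, [/\ (0 < g)%N, v = g%:Z *: v' & dot v' u = 1].
Proof.
move=> v0.
pose p k := `[< (0 < k)%N /\ exists u, dot v u = k%:Z >].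
have exp : exists k, p k.
  have [j vj] : exists j, v 0 j != 0.
    by apply: contra_notP (negP v0) => /forallNP nv; apply/eqP/rowP => j;
       rewrite mxE; apply/eqP/negPn/negP; exact: nv.
  exists `|v 0%R j|%N; apply/asboolP; split; first by rewrite absz_gt0.
  exists ((-1) ^+ (v 0 j < 0)%R *: delta_mx 0 j).
  by rewrite dotZr dot_delta abszE normrEsign.
case: (ex_minnP exp) => g /asboolP[g0 [u vu]] gmin.
have vg j : v 0 j = (v 0%R j %/ g%:Z)%Z * g%:Z.
  have := divz_eq (v 0 j) g%:Z.
  set q := (v 0%R j %/ _)%Z; set r := (v 0%R j %% _)%Z => vE.
  have r0 : 0 <= r by rewrite modz_ge0//; lia.
  have rg : r < g%:Z by rewrite ltz_pmod.
  have dr : dot v (delta_mx 0 j - q *: u) = r.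
    by rewrite dotBr dot_delta dotZr vu vE addrC addKr.
  have [r00|rn0] := eqVneq r 0; first by rewrite vE r00 addr0.
  have /gmin : p `|r|%N.
    by apply/asboolP; split; [lia|exists (delta_mx 0 j - q *: u); rewrite dr; lia].
  by lia.
exists g, (\row_j (v 0%R j %/ g%:Z)%Z), u; split=> //.
  by apply/rowP => j; rewrite !mxE mulrC -vg.
apply: (@mulfI _ g%:Z); first by lia.
rewrite mulr1 -[RHS]vu -dotZl; congr (dot _ u).
by apply/rowP => j; rewrite !mxE mulrC -vg.
Qed.

End Bezout.

(** * Primitive normals and lattice translations of integer hulls *)

Section Lattice.
Context {R : realType} {n : nat}.
Implicit Types (C P Q X H : set 'rV[R]_n) (x y z k : 'rV[R]_n).
Local Notation intv a := (map_mx intr a : 'rV[R]_n).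

Lemma inner_intv (a u : 'rV[int]_n) : inner (intv a) (intv u) = (dot a u)%:~R :> R.
Proof. by rewrite rmorph_sum; apply: eq_bigr => j _; rewrite !mxE rmorphM. Qed.

Lemma intv_int (u : 'rV[int]_n) : intv u \is a mxOver Num.int.
Proof. by apply/mxOverP => i j; rewrite mxE intr_int. Qed.

Lemma common_denominator (a : 'rV[rat]_n) :
  exists (N : nat) (v : 'rV[int]_n), (0 < N)%N /\ N%:R *: a = map_mx intr v.
Proof.
pose N := (\prod_j `|denq (a 0%R j)|)%N.
exists N, (\row_j (numq (a 0 j) * (\prod_(i | i != j) `|denq (a 0%R i)|)%N%:Z)).
split.
  by rewrite /N prodn_gt0// => j; rewrite absz_gt0 denq_neq0.
apply/rowP => j; rewrite !mxE /N (bigD1 j)//= natrM rmorphM/=.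
rewrite mulrAC -pmulrn; congr (_ * _).
rewrite pmulrn abszE gtr0_norm ?denq_gt0// mulrC.
by rewrite -[X in X * _]divq_num_den divfK// intr_eq0 denq_neq0.
Qed.

(** A primitive normal [e] takes the value 1 at a lattice vector [u], so it can serve as a lattice
    coordinate. *)
Lemma rational_halfspace_primitive H : rational_halfspace H ->
  exists (e u : 'rV[int]_n) (b : R), dot e u = 1 /\ H = halfspace (intv e) b.
Proof.
move=> [a [b [a0 ->]]].
have [N [v [N0 Nv]]] := common_denominator a.
have v0 : v != 0.
  apply: contra_neq a0 => v0.
  have /eqP : N%:R *: a = 0 by rewrite Nv v0 map_mx0.
  by rewrite scaler_eq0 pnatr_eq0 => /orP[/eqP N00|/eqP//]; rewrite N00 in N0.
have [g [e [u [g0 vE eu]]]] := primitive_vector v0.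
exists e, u, (ratr b * N%:R / g%:R); split=> //.
have aE : map_mx ratr a = (g%:R / N%:R) *: intv e.
  have : map_mx ratr (N%:R *: a) = g%:R *: intv e.
    rewrite Nv vE map_mxZ; apply/rowP => j.
    by rewrite !mxE !rmorphM/= !ratr_int.
  rewrite map_mxZ/= rmorph_nat => NE.
  rewrite mulrC -scalerA -NE scalerA mulVf ?scale1r//.
  by rewrite pnatr_eq0 -lt0n.
have gp : 0 < g%:R :> R by rewrite ltr0n.
have Np : 0 < N%:R :> R by rewrite ltr0n.
apply/seteqP; split => x; rewrite /halfspace /= aE innerZl.
  by rewrite mulrAC ler_pdivrMr// mulrC -ler_pdivlMr.
by rewrite ler_pdivlMr// => hx; rewrite mulrAC ler_pdivrMr// mulrC.
Qed.

(** Integer points of [C] may be moved by every natural multiple of [r]; a real multiple lies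
    between two consecutive natural ones. *)
Lemma integer_hull_ray C (r : 'rV[int]_n) (t : R) x :
  (forall z, C z -> C (z + intv r)) -> 0 <= t ->
  integer_hull C x -> integer_hull C (x + t *: intv r).
Proof.
move=> Cr t0; apply: hull_translate => z [Cz zint].
have Cm m : convex_hull (C `&` [set x | x \is a mxOver Num.int]) (z + m%:R *: intv r).
  apply: sub_hull; split=> /=; last first.
    apply/mxOverP => i j; rewrite !mxE rpredD ?rpredM ?natr_int ?intr_int//.
    exact: (mxOverP zint).
  elim: m => [|m IH]; first by rewrite scale0r addr0.
  by rewrite -natr1 scalerDl scale1r addrA; exact: Cr.
have /andP[t1 t2] := truncn_itv t0.
apply: (@hull_between _ _ _ _ (intv r) (t - (Num.truncn t)%:R) ((Num.truncn t).+1%:R - t)).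
- by rewrite subr_ge0.
- by rewrite subr_ge0 ltW.
- have := Cm (Num.truncn t); congr (convex_hull _ _).
  by apply/rowP => i; rewrite !mxE; ring.
- have := Cm (Num.truncn t).+1; congr (convex_hull _ _).
  by apply/rowP => i; rewrite !mxE; ring.
Qed.

Lemma integer_hull_line C (r : 'rV[int]_n) (t : R) x :
  (forall z, C z -> C (z + intv r)) -> (forall z, C z -> C (z - intv r)) ->
  integer_hull C x -> integer_hull C (x + t *: intv r).
Proof.
move=> C1 C2 Cx; have [t0|t0] := leP 0 t; first exact: integer_hull_ray.
have := @integer_hull_ray C (- r) (- t) x; rewrite map_mxN scalerN scaleNr opprK.
by apply=> //; rewrite oppr_ge0 ltW.
Qed.

(* With [u], [w] dual to [e], [f], the integer vectors
   [e_j - e 0 j u - f 0 j w] span the common kernel of [e] and [f]. *)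
Lemma integer_hull_kernel C (e f u w : 'rV[int]_n) x k :
  let r j := delta_mx 0 j - e 0 j *: u - f 0 j *: w in
  (forall j z, C z -> C (z + intv (r j))) ->
  (forall j z, C z -> C (z - intv (r j))) ->
  inner (intv e) k = 0 -> inner (intv f) k = 0 ->
  integer_hull C x -> integer_hull C (x + k).
Proof.
move=> r C1 C2 ek fk Cx.
have -> : k = \sum_j k 0 j *: intv (r j).
  apply/rowP => i; rewrite summxE.
  under eq_bigr do rewrite !mxE !rmorphB !rmorphM/=.
  transitivity (\sum_j (k 0 j * (i == j)%:R) - inner (intv e) k * (u 0 i)%:~R
     - inner (intv f) k * (w 0 i)%:~R).
    rewrite ek fk !mul0r !subr0 (bigD1 i)//= eqxx mulr1 big1 ?addr0// => j ij.
    by rewrite eq_sym (negbTE ij) mulr0.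
  rewrite !mulr_suml -!sumrB; apply: eq_bigr => j _.
  by rewrite !mxE rmorph_nat; set b := _%:R; ring.
suff : forall s : seq 'I_n, integer_hull C (x + \sum_(j <- s) k 0 j *: intv (r j)).
  by apply.
elim=> [|j s IH]; first by rewrite big_nil addr0.
rewrite big_cons [X in x + X]addrC addrA.
by apply: integer_hull_line => // z; [exact: C1|exact: C2].
Qed.

End Lattice.

(** * Wedges with independent normals *)

Section Wedge.
Context {R : realType} {n : nat}.
Local Notation intv a := (map_mx intr a : 'rV[R]_n).
Variables (e f u w : 'rV[int]_n) (h : int) (d : nat) (b1 b2 : R).
Hypotheses (eu : dot e u = 1) (fu : dot f u = 0) (ew : dot e w = 0)
  (fw : dot f w = 1) (d_gt0 : (0 < d)%N).

(** In the lattice coordinates [e] and [f], with dual vectors [u] and [w], this is the region left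
    of [e = b1] and below a line of slope [- h / d]. *)
Let C : set 'rV[R]_n :=
  [set z | inner (intv e) z <= b1 /\
           h%:~R * inner (intv e) z + d%:R * inner (intv f) z <= b2].
Let B : int := Num.floor b1.
(** The height of the topmost lattice points of [C] in the column [e = B - i]; columns are counted
    leftwards from the rightmost integer one. *)
Let g (i : nat) : int := Num.floor ((b2 - h%:~R * (B - i%:Z)%:~R) / d%:R).
Let vtx (i : nat) : 'rV[int]_n := (B - i%:Z) *: u + g i *: w.

Let dR : 0 < d%:R :> R. Proof. by rewrite ltr0n. Qed.

Let evtx i : inner (intv e) (intv (vtx i)) = (B - i%:Z)%:~R.
Proof. by rewrite inner_intv dotDr !dotZr eu ew mulr1 mulr0 addr0. Qed.

Let fvtx i : inner (intv f) (intv (vtx i)) = (g i)%:~R.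
Proof. by rewrite inner_intv dotDr !dotZr fu fw mulr1 mulr0 add0r. Qed.

Let C_vtx i : C (intv (vtx i)).
Proof.
rewrite /C /= evtx fvtx; split.
  by apply: le_trans (floor_le b1); rewrite ler_int gerBl.
rewrite addrC -lerBrDr mulrC -ler_pdivlMr//; exact: floor_le.
Qed.

Let C_convex : @convex_set R 'rV[R]_n C.
Proof.
apply/convex_setP => x y t [x1 x2] [y1 y2] t0 t1; split; rewrite !innerE; first nra.
set ex := inner _ x in x2 *; set ey := inner _ y in y2 *.
set fx := inner _ x in x2 *; set fy := inner _ y in y2 *.
have -> : h%:~R * (t * ex + (1 - t) * ey) + d%:R * (t * fx + (1 - t) * fy) =
  t * (h%:~R * ex + d%:R * fx) + (1 - t) * (h%:~R * ey + d%:R * fy) by ring.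
nra.
Qed.

(** Over [d] columns the height of the line changes by exactly the integer [h], which passes through
    the floor. *)
Let g_periodic i : g (i + d)%N = g i + h.
Proof.
rewrite /g; set x := (b2 - _ * (B - i%:Z)%:~R) / _.
have -> : (b2 - h%:~R * (B - (i + d)%:Z)%:~R) / d%:R = x + h%:~R.
  rewrite /x PoszD !rmorphB rmorphD/= -!pmulrn; field; exact: lt0r_neq0.
by rewrite floorDrz ?intr_int//= intrKfloor.
Qed.

Let lattice_le_g (s y : int) z : C z -> inner (intv e) z = s%:~R -> inner (intv f) z = y%:~R ->
  exists2 k : nat, s = B - k%:Z & y <= g k.
Proof.
move=> [z1 z2] es fy.
have sB : s <= B by rewrite floor_ge_int -es.
exists `|B - s|%N; first by lia.
rewrite /g floor_ge_int ler_pdivlMr//.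
have -> : B - `|B - s|%N%:Z = s by lia.
by rewrite -fy -es; lra.
Qed.

(** The form [c] is constant along the edge, and [b] completes it to a unimodular pair. A point of
    [C] at the next level of [c] with an integer value of [b] would have integer coordinates and lie
    above the upper hull, so [split_closure_twice_cut] applies. *)
Let edge_valid i j : (i < j)%N ->
  (forall k, (g k - g i) * (j%:Z - i%:Z) <= (g j - g i) * (k%:Z - i%:Z)) ->
  forall x, split_closure (split_closure C) x ->
  (inner (intv f) x - (g i)%:~R) * (j%:R - i%:R) <=
  (g j - g i)%:~R * (B%:~R - inner (intv e) x - i%:R).
Proof.
move=> ij ijmax x Sx.
pose D : int := j%:Z - i%:Z; pose T := g j - g i.
have D0 : 0 < D by rewrite /D; lia.
(* Dividing by the gcd gives the primitive edge direction [(- D', T')] in the coordinates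
   [(e, f)]. *)
have [G GE] : exists G, G = gcdz D T by exists (gcdz D T).
have G0 : 0 < G by rewrite GE lt0r gcdz_eq0 le0z_nat andbT negb_and lt0r_neq0.
have [D' DE] : exists D', D = D' * G by rewrite GE; apply/dvdzP; exact: dvdz_gcdl.
have [T' TE] : exists T', T = T' * G by rewrite GE; apply/dvdzP; exact: dvdz_gcdr.
have [m1 [m2 mE]] : exists m1 m2, m1 * D' + m2 * T' = 1.
  have [m1 [m2 mG]] := Bezoutz D T.
  exists m1, m2; apply: (@mulIf _ G); first by lia.
  by rewrite mul1r mulrDl -!mulrA -DE -TE GE.
have GR : 0 < G%:~R :> R by rewrite ltr0z.
pose c := D' *: f + T' *: e.
pose b := - m1 *: e + m2 *: f.
have cE z : inner (intv c) z = D'%:~R * inner (intv f) z + T'%:~R * inner (intv e) z.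
  by rewrite map_mxD !map_mxZ innerDl !innerZl.
have bE z : inner (intv b) z = - m1%:~R * inner (intv e) z + m2%:~R * inner (intv f) z.
  by rewrite map_mxD !map_mxZ innerDl !innerZl rmorphN.
have mR : m1%:~R * D'%:~R + m2%:~R * T'%:~R = 1 :> R.
  by rewrite -!rmorphM -rmorphD mE.
(* [q] is the lattice point following [p] on the edge; from [p] to [q] the form [b] grows by
   [m1 * D' + m2 * T' = 1]. *)
pose p := intv (vtx i); pose q := p + G%:~R^-1 *: (intv (vtx j) - p).
have eq : inner (intv e) q = (B - i%:Z)%:~R - D'%:~R.
  rewrite /q innerDr innerZr innerBr !evtx -rmorphB/=.
  have -> : B - j%:Z - (B - i%:Z) = - (D' * G) by rewrite -DE /D; ring.
  by rewrite rmorphN rmorphM/=; field; exact: lt0r_neq0.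
have fq : inner (intv f) q = (g i)%:~R + T'%:~R.
  rewrite /q innerDr innerZr innerBr !fvtx -rmorphB/= -/T TE.
  by rewrite rmorphM/=; field; exact: lt0r_neq0.
pose dl := D' * g i + T' * (B - i%:Z).
have Cq : C q.
  have -> : q = G%:~R^-1 *: intv (vtx j) + (1 - G%:~R^-1) *: p.
    by rewrite /q; apply/rowP => l; rewrite !mxE; ring.
  move/convex_setP: C_convex; apply; rewrite ?invr_ge0 ?ler0z; [exact: C_vtx|exact: C_vtx|exact: ltW|].
  by rewrite invf_le1// ler1z; lia.
have : halfspace (intv c) dl%:~R x.
  apply: (@split_closure_twice_cut _ _ C b c dl (- m1 * (B - i%:Z) + m2 * g i) p q) => //.
  - exact: C_vtx.
  - by rewrite cE evtx fvtx /dl [RHS]rmorphD !rmorphM.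
  - by rewrite cE eq fq /dl [RHS]rmorphD !rmorphM/=; ring.
  - by rewrite bE evtx fvtx [RHS]rmorphD !rmorphM rmorphN.
  - rewrite bE eq fq [RHS]rmorphD [X in _ = X + _]rmorphD !rmorphM rmorphN/=.
    rewrite -[X in _ = _ + X]mR; ring.
  (* Inverting the pair gives integer values of [e] and [f] at [z]. The height of [z] is then at
     most that of its column, and domination by the edge forces the value of [c] to be at most
     [dl]. *)
  move=> z k Cz; rewrite cE bE => cz bz.
  have ez : inner (intv e) z = (m2 * (dl + 1) - D' * k)%:~R.
    rewrite rmorphB !rmorphM/= -cz -bz.
    by rewrite -[LHS]mul1r -[X in X * _ = _]mR; ring.
  have fz : inner (intv f) z = (m1 * (dl + 1) + T' * k)%:~R.
    rewrite rmorphD !rmorphM/= -cz -bz.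
    by rewrite -[LHS]mul1r -[X in X * _ = _]mR; ring.
  have [k' sE yk] := lattice_le_g Cz ez fz.
  have czI : D' * (m1 * (dl + 1) + T' * k) + T' * (m2 * (dl + 1) - D' * k) = dl + 1.
    by rewrite -[RHS]mul1r -[X in _ = X * _]mE; ring.
  have := ijmax k'; rewrite -/D -/T DE TE mulrA [leRHS]mulrAC ler_pM2r//.
  have D'0 : 0 < D' by rewrite -(pmulr_lgt0 _ G0) -DE.
  move: czI; rewrite sE /dl => czI.
  nia.
rewrite /halfspace /= cE /dl => hx.
have -> : j%:R - i%:R = D'%:~R * G%:~R :> R by rewrite -rmorphM -DE /D rmorphB.
rewrite -/T TE rmorphM/= mulrA [leRHS]mulrAC ler_pM2r//.
by move: hx; rewrite rmorphD !rmorphM rmorphB/= -pmulrn; lra.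
Qed.

(** Take the edge of the upper hull spanning the column of [x]. Its point [y0] in that column lies
    in the integer hull and, by [edge_valid], not below [x]. Going down along [- w] and then along
    the common kernel of [e] and [f] leads from [y0] to [x]. *)
Lemma wedge_split_rank :
  split_closure (split_closure C) `<=` integer_hull C.
Proof.
move=> x Sx.
have Cx : split_closure C x.
  exact: split_closure_mono (split_closure_sub C_convex) _ Sx.
have eB : inner (intv e) x <= B%:~R.
  apply: (split_closure_cut (X := C) (c := e)) => // z [z1 _].
  by apply: le_lt_trans z1 _; case/andP: (floor_itv b1).
pose t := B%:~R - inner (intv e) x.
have t0 : 0 <= t by rewrite subr_ge0.
have /andP[tm mt] := truncn_itv t0.
have [i [j [im mj ijmax]]] := upper_hull_edge (Num.truncn t) d_gt0 g_periodic.
have ij : (i < j)%N by exact: leq_ltn_trans im mj.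
have := edge_valid ij ijmax Sx; rewrite -/t => edge.
have it : i%:R <= t by apply: le_trans tm; rewrite ler_nat.
have tj : t <= j%:R by apply: le_trans (ltW mt) _; rewrite ler_nat.
have ijR : 0 < j%:R - i%:R :> R by rewrite subr_gt0 ltr_nat.
pose m := (t - i%:R) / (j%:R - i%:R).
have m0 : 0 <= m by apply: divr_ge0; [rewrite subr_ge0|exact: ltW].
have m1 : m <= 1 by rewrite ler_pdivrMr// mul1r lerD2r.
pose y0 := m *: intv (vtx j) + (1 - m) *: intv (vtx i).
have hv k : integer_hull C (intv (vtx k)).
  by apply: sub_hull; split; [exact: C_vtx|exact: intv_int].
have hy0 : integer_hull C y0 by apply: hull_convex => //; exact: hv.
have ey0 : inner (intv e) y0 = inner (intv e) x.
  rewrite innerDr !innerZr !evtx !rmorphB/= -!pmulrn /m /t; field; lra.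
pose r := inner (intv f) y0 - inner (intv f) x.
have r0 : 0 <= r.
  rewrite /r innerDr !innerZr !fvtx.
  have -> : m * (g j)%:~R + (1 - m) * (g i)%:~R - inner (intv f) x =
     ((g j - g i)%:~R * (t - i%:R) - (inner (intv f) x - (g i)%:~R) * (j%:R - i%:R))
     / (j%:R - i%:R) by rewrite rmorphB/= /m; field; lra.
  by rewrite divr_ge0 ?(ltW ijR)// subr_ge0.
have eW : inner (intv e) (intv (- w)) = 0.
  by rewrite inner_intv -scaleN1r dotZr ew mulr0.
have fW : inner (intv f) (intv (- w)) = -1.
  by rewrite inner_intv -scaleN1r dotZr fw mulr1.
have hy1 : integer_hull C (y0 + r *: intv (- w)).
  apply: integer_hull_ray => // z [z1 z2].
  split; rewrite !innerDr eW ?fW addr0 // mulrBr mulr1; have := dR; lra.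
have -> : x = y0 + r *: intv (- w) + (x - (y0 + r *: intv (- w))) by rewrite addrC subrK.
have er l : inner (intv e) (intv (delta_mx 0 l - e 0 l *: u - f 0 l *: w)) = 0.
  by rewrite inner_intv !dotBr !dotZr dot_delta eu ew mulr1 mulr0 subr0 subrr.
have fr l : inner (intv f) (intv (delta_mx 0 l - e 0 l *: u - f 0 l *: w)) = 0.
  by rewrite inner_intv !dotBr !dotZr dot_delta fu fw mulr1 mulr0 subr0 subrr.
apply: (integer_hull_kernel (e := e) (f := f) (u := u) (w := w)) => //.
- by move=> l z [z1 z2]; split; rewrite !innerDr er ?fr !addr0.
- by move=> l z [z1 z2]; split; rewrite !innerBr er ?fr !subr0.
- by rewrite innerBr innerDr innerZr eW ey0; ring.
- by rewrite innerBr innerDr innerZr fW /r; ring.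
Qed.

End Wedge.

(** * Arbitrary pairs of rational halfspaces *)

Section TwoHalfspaces.
Context {R : realType} {n : nat}.
Implicit Types (C P Q X H : set 'rV[R]_n) (x y z k : 'rV[R]_n).
Local Notation intv a := (map_mx intr a : 'rV[R]_n).

(** This serves parallel boundaries, where membership depends on [e] alone: along [u] two integer
    levels enclose that of [x], and the kernel of [e] is free. *)
Lemma slab_hull (e u : 'rV[int]_n) (I : set R) (lo hi : int) x :
  dot e u = 1 -> I lo%:~R -> I hi%:~R ->
  lo%:~R <= inner (intv e) x -> inner (intv e) x <= hi%:~R ->
  integer_hull [set z | I (inner (intv e) z)] x.
Proof.
move=> eu Ilo Ihi xlo xhi; set C := [set z | _].
have lC l : I l%:~R -> integer_hull C (l%:~R *: intv u).
  move=> Il; rewrite -map_mxZ; apply: sub_hull; split=> /=; last exact: intv_int.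
  by rewrite /C /= inner_intv dotZr eu mulr1.
have hy : integer_hull C (inner (intv e) x *: intv u).
  apply: (@hull_between _ _ _ _ (intv u) (inner (intv e) x - lo%:~R) (hi%:~R - inner (intv e) x)).
  - by rewrite subr_ge0.
  - by rewrite subr_ge0.
  - by rewrite -scalerBl opprB addrC subrK; exact: lC.
  - by rewrite -scalerDl addrC subrK; exact: lC.
have -> : x = inner (intv e) x *: intv u + (x - inner (intv e) x *: intv u).
  by rewrite addrC subrK.
have er l : inner (intv e) (intv (delta_mx 0 l - e 0 l *: u - (0 : 'rV_n) 0 l *: 0)) = 0.
  by rewrite inner_intv !dotBr !dotZr dot_delta eu mulr1 mxE mul0r subr0 subrr.
apply: (integer_hull_kernel (e := e) (f := 0) (u := u) (w := 0)) => //.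
- by move=> l z Cz; rewrite /C /= innerDr er addr0.
- by move=> l z Cz; rewrite /C /= innerBr er subr0.
- by rewrite innerBr innerZr inner_intv eu mulr1 subrr.
- by rewrite map_mx0 inner0l.
Qed.

Lemma two_halfspaces_split_rank H1 H2 :
  rational_halfspace H1 -> rational_halfspace H2 ->
  split_closure (split_closure (H1 `&` H2)) `<=` integer_hull (H1 `&` H2).
Proof.
move=> /rational_halfspace_primitive[e [u [b1 [eu ->]]]].
move=> /rational_halfspace_primitive[e2 [u2 [b2 [eu2 ->]]]].
set C := _ `&` _.
have cC : @convex_set R 'rV[R]_n C.
  by apply: convex_setI; exact: halfspace_convex.
pose h := dot e2 u.
(* If the boundaries are parallel, [h] is 1 or -1 because both normals are primitive, and one split
   closure already rounds both bounds. *)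
have [fv|fv] := eqVneq (e2 - h *: e) 0.
  have e2E : e2 = h *: e by apply/eqP; rewrite -subr_eq0 fv.
  have hunit : h * dot e u2 = 1 by rewrite -dotZl -e2E.
  move=> x Sx; have SSx : split_closure C x.
    exact: split_closure_mono (split_closure_sub cC) _ Sx.
  have cut1 : inner (intv e) x <= (Num.floor b1)%:~R.
    apply: (split_closure_cut (X := C) (c := e)) => // z [z1 _].
    by apply: le_lt_trans z1 _; case/andP: (floor_itv b1).
  have cut2 : inner (intv e2) x <= (Num.floor b2)%:~R.
    apply: (split_closure_cut (X := C) (c := e2)) => // z [_ z2].
    by apply: le_lt_trans z2 _; case/andP: (floor_itv b2).
  have e2E' z : inner (intv e2) z = h%:~R * inner (intv e) z.
    by rewrite e2E map_mxZ innerZl.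
  have -> : C = [set z | [set s | s <= b1 /\ h%:~R * s <= b2] (inner (intv e) z)].
    by apply/seteqP; split=> z; rewrite /C /halfspace /= e2E'.
  have habs : `|h|%N = 1%N.
    by have /(congr1 absz)/eqP := hunit; rewrite abszM muln_eq1 => /andP[/eqP].
  have [h1|h1] : h = 1 \/ h = -1 by clear -habs; lia.
    (* Here the intersection is a single halfspace, so any integer level not above that of [x] can
       be the lower end. *)
    pose hi := Num.min (Num.floor b1) (Num.floor b2).
    have lohi : Num.floor (inner (intv e) x) <= hi.
      rewrite le_min; apply/andP; split; apply: le_floor => //.
        exact: le_trans cut1 (floor_le _).
      by move: cut2; rewrite e2E' h1 mul1r => cut2; exact: le_trans cut2 (floor_le _).
    have hi1 : hi%:~R <= b1.
      by apply: le_trans (floor_le b1); rewrite ler_int ge_min lexx.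
    have hi2 : hi%:~R <= b2.
      by apply: le_trans (floor_le b2); rewrite ler_int ge_min lexx orbT.
    have lo1 : (Num.floor (inner (intv e) x))%:~R <= hi%:~R :> R by rewrite ler_int.
    apply: (@slab_hull e u _ (Num.floor (inner (intv e) x)) hi) => //=.
    - by rewrite h1; split; lra.
    - by rewrite h1; split; lra.
    - exact: floor_le.
    - move: cut2; rewrite e2E' h1 mul1r => cut2.
      by rewrite /hi; case: (leP (Num.floor b1) (Num.floor b2)).
  move: cut2; rewrite e2E' h1 mulN1r => cut2.
  have f1 := floor_le b1; have f2 := floor_le b2.
  apply: (@slab_hull e u _ (- Num.floor b2) (Num.floor b1)) => //=;
    rewrite ?h1 ?rmorphN/=; [split; lra|split; lra|lra].
(* Now [e2 = h e + d f] with [f] primitive. Correcting [w0] by a multiple of [u] makes [u], [w] dual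
   to [e], [f]. *)
have [d [f [w0 [d0 fE fw0]]]] := primitive_vector fv.
have dfu : d%:Z * dot f u = 0.
  by rewrite -dotZl -fE dotBl dotZl eu mulr1 subrr.
have fu : dot f u = 0 by move/eqP: dfu; rewrite mulf_eq0 => /orP[|/eqP//]; lia.
pose w := w0 - dot e w0 *: u.
have ew : dot e w = 0 by rewrite dotBr dotZr eu mulr1 subrr.
have fw : dot f w = 1 by rewrite dotBr dotZr fu mulr0 subr0.
have := wedge_split_rank eu fu ew fw (h := h) (b1 := b1) (b2 := b2) d0.
suff -> : C = [set z | inner (intv e) z <= b1 /\
  h%:~R * inner (intv e) z + d%:R * inner (intv f) z <= b2] by [].
have e2E z : inner (intv e2) z = h%:~R * inner (intv e) z + d%:R * inner (intv f) z.
  have -> : e2 = h *: e + d%:Z *: f by rewrite -fE addrC subrK.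
  by rewrite map_mxD !map_mxZ innerDl !innerZl.
by apply/seteqP; split=> z; rewrite /C /halfspace /= e2E.
Qed.

Lemma split_closure_twice_sub X :
  split_closure (split_closure X) `<=` two_halfspace_closure X.
Proof.
move=> x Sx H1 H2 rH1 rH2 XH; apply: two_halfspaces_split_rank => //.
exact: split_closure_mono (split_closure_mono XH) _ Sx.
Qed.

End TwoHalfspaces.

(** * Duality for disjunctive hulls *)

Section FourierMotzkin.
Context {R : realFieldType}.

(** The pairwise condition puts every lower bound on [t] below every upper bound. The largest lower
    bound is a solution, or the smallest upper bound if there is no lower one. *)
Lemma univariate_system (I : finType) (c e : I -> R) :
  (forall i, c i = 0 -> 0 <= e i) ->
  (forall i k, 0 < c i -> c k < 0 -> 0 <= - c k * e i + c i * e k) ->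
  exists t, forall i, c i * t <= e i.
Proof.
move=> c0 cpn.
have sol t : (forall i, 0 < c i -> t <= e i / c i) ->
    (forall i, c i < 0 -> e i / c i <= t) -> forall i, c i * t <= e i.
  move=> h1 h2 i; have [ci|ci|ci] := ltgtP (c i) 0; last by rewrite ci mul0r c0.
    by rewrite mulrC -ler_ndivrMr ?h2.
  by rewrite mulrC -ler_pdivlMr ?h1.
have [|nneg] := pselect (exists i, c i < 0).
  move=> [i0 ci0]; case: (@arg_maxP _ R I i0 (fun i => c i < 0) (fun i => e i / c i) ci0) => k ck kmax.
  exists (e k / c k); apply: sol => i ci; last exact: kmax.
  rewrite ler_pdivlMr// mulrAC ler_ndivrMr//.
  have := cpn i k ci ck; lra.
have [|npos] := pselect (exists i, 0 < c i).
  move=> [i0 ci0]; case: (@arg_minP _ R I i0 (fun i => 0 < c i) (fun i => e i / c i) ci0) => k ck kmin.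
  exists (e k / c k); apply: sol => i ci; first exact: kmin.
  by case: nneg; exists i.
exists 0; apply: sol => i ci; first by case: npos; exists i.
by case: nneg; exists i.
Qed.

(* Fourier-Motzkin elimination: finitely many nonnegative rational multipliers
   annihilating the rational matrix [C] certify the (in)feasibility of
   [C y <= d] for every real right-hand side [d] at once. *)
Lemma fourier_motzkin (N : nat) (I : finType) (C : I -> nat -> rat) :
  exists (J : finType) (W : J -> I -> rat),
    [/\ forall j i, 0 <= W j i,
        forall j k, (k < N)%N -> \sum_i W j i * C i k = 0 &
        forall d : I -> R, (forall j, 0 <= \sum_i ratr (W j i) * d i) ->
          exists y : nat -> R, forall i, \sum_(k < N) ratr (C i k) * y k <= d i].
Proof.
elim: N I C => [|N IH] I C.
  exists I, (fun j i => (j == i)%:R); split=> // d d0.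
  exists (fun=> 0) => i; rewrite big_ord0; have := d0 i.
  rewrite (bigD1 i)//= eqxx rmorph1 mul1r big1 ?addr0// => j ji.
  by rewrite eq_sym (negbTE ji) rmorph0 mul0r.
(* The new system is indexed by pairs of rows: a first row free of variable [N] is kept, a positive
   first and a negative second row are combined so that [N] cancels, and the remaining pairs give
   zero rows. *)
pose V (p : I * I) (l : I) : rat :=
  if C p.1 N == 0 then (p.1 == l)%:R
  else if (0 < C p.1 N) && (C p.2 N < 0)
  then - C p.2 N * (p.1 == l)%:R + C p.1 N * (p.2 == l)%:R else 0.
have V0 p l : 0 <= V p l.
  rewrite /V; case: ifP => _; first exact: ler0n.
  case: ifP => // /andP[h1 h2].
  by rewrite addr_ge0// mulr_ge0 ?ler0n// ?oppr_ge0 ltW.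
have sumD (F : I -> rat) i : \sum_l (i == l)%:R * F l = F i.
  rewrite (bigD1 i)//= eqxx mul1r big1 ?addr0// => j ji.
  by rewrite eq_sym (negbTE ji) mul0r.
have sumDR (F : I -> R) i : \sum_l ratr (i == l)%:R * F l = F i.
  rewrite (bigD1 i)//= eqxx rmorph1 mul1r big1 ?addr0// => j ji.
  by rewrite eq_sym (negbTE ji) rmorph0 mul0r.
have sumDR2 (F : I -> R) (a b : R) i k :
    \sum_l (a * ratr (i == l)%:R + b * ratr (k == l)%:R) * F l = a * F i + b * F k.
  rewrite -(sumDR F i) -(sumDR F k) !mulr_sumr -big_split.
  by apply: eq_bigr => l _; rewrite !ratr_nat /=; ring.
have VN p : \sum_l V p l * C l N = 0.
  rewrite /V; case: eqP => [c0|_]; first by rewrite sumD.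
  case: ((0 < C p.1 N) && (C p.2 N < 0)); last by rewrite big1// => l _; rewrite mul0r.
  under eq_bigr do rewrite mulrDl -!mulrA.
  by rewrite big_split/= -!mulr_sumr !sumD; ring.
have [J [W [W0 WC Wsol]]] := IH _ (fun p k => \sum_l V p l * C l k).
exists J, (fun j l => \sum_p W j p * V p l).
have WV j (F : I -> rat) : \sum_l (\sum_p W j p * V p l) * F l =
    \sum_p W j p * \sum_l V p l * F l.
  under eq_bigr do rewrite mulr_suml.
  rewrite exchange_big; apply: eq_bigr => p _; rewrite mulr_sumr.
  by apply: eq_bigr => l _; rewrite mulrA.
split.
- by move=> j i; apply: sumr_ge0 => p _; exact: mulr_ge0.
- move=> j k; rewrite ltnS leq_eqVlt => /orP[/eqP->|kN]; last by rewrite WV WC.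
  by rewrite WV big1// => p _; rewrite VN mulr0.
move=> d hd.
have [|y hy] := Wsol (fun p => \sum_l ratr (V p l) * d l).
  move=> j; move: (hd j); congr (0 <= _).
  under eq_bigr do rewrite rmorph_sum/= mulr_suml.
  rewrite exchange_big; apply: eq_bigr => p _; rewrite mulr_sumr.
  by apply: eq_bigr => l _; rewrite rmorphM/= mulrA.
(* The slack left for variable [N]; diagonal pairs settle the zero coefficients and mixed pairs
   compare lower with upper bounds. *)
pose e l := d l - \sum_(k < N) ratr (C l k) * y k.
have he p : 0 <= \sum_l ratr (V p l) * e l.
  under eq_bigr do rewrite mulrBr.
  rewrite sumrB subr_ge0; apply: le_trans (hy p).
  under [X in _ <= X]eq_bigr do rewrite rmorph_sum/= mulr_suml.
  rewrite exchange_big; apply: ler_sum => l _; rewrite mulr_sumr.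
  by apply: ler_sum => k _; rewrite rmorphM/= mulrA.
have [||t ht] := @univariate_system I (fun i => ratr (C i N)) e.
- move=> i /eqP; rewrite fmorph_eq0 => ci.
  by have := he (i, i); rewrite /V /= ci sumDR.
- move=> i k; rewrite ltr0q ltrq0 => ci ck.
  have := he (i, k); rewrite /V /= gt_eqF// ci ck/=.
  have ratrM (u v : rat) : ratr (u * v) = ratr u * ratr v :> R by exact: rmorphM.
  have ratrD (u v : rat) : ratr (u + v) = ratr u + ratr v :> R by exact: rmorphD.
  under eq_bigr do rewrite ratrD !ratrM rmorphN.
  by rewrite sumDR2.
exists (fun k => if (k < N)%N then y k else t) => i.
rewrite big_ord_recr/= ltnn.
under eq_bigr do rewrite ltn_ord.
by have := ht i; rewrite /e; lra.
Qed.

End FourierMotzkin.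

Lemma sum_option (V : nmodType) (I : finType) (F : option I -> V) :
  \sum_i F i = F None + \sum_i F (Some i).
Proof.
rewrite (bigD1 None)//=; congr (_ + _).
rewrite (reindex_omap Some id) => [|[]//].
by apply: eq_bigl => i; rewrite /= eqxx.
Qed.

(** * Hulls of unions of polyhedra and of split disjunctions *)

Section Balas.
Context {R : realType} {n : nat}.
Implicit Types (C P Q X H : set 'rV[R]_n) (x y z r : 'rV[R]_n).
Local Notation intv a := (map_mx intr a : 'rV[R]_n).
Local Notation ratv a := (map_mx ratr a : 'rV[R]_n).

Lemma inner_ratv_sum (I : finType) (k : I -> rat) (v : I -> 'rV[rat]_n) x :
  inner (ratv (\sum_i k i *: v i)) x = \sum_i ratr (k i) * inner (ratv (v i)) x.
Proof.
rewrite map_mx_sum inner_suml; apply: eq_bigr => i _.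
by rewrite map_mxZ innerZl.
Qed.

Lemma ratr_sumM (I : finType) (k v : I -> rat) :
  ratr (\sum_i k i * v i) = \sum_i ratr (k i) * ratr (v i) :> R.
Proof. by rewrite rmorph_sum; apply: eq_bigr => i _; exact: rmorphM. Qed.

(* Balas' extended formulation of the union of two polyhedra, with the
   homogenizing variables [y] and [t] projected out. *)
Lemma union_hull_system (I1 I2 : finType) (a1 : I1 -> 'rV[rat]_n) (b1 : I1 -> rat)
    (a2 : I2 -> 'rV[rat]_n) (b2 : I2 -> rat) :
  exists (J : finType) (u : J -> I1 -> rat) (v : J -> I2 -> rat),
  [/\ forall j i, 0 <= u j i, forall j i, 0 <= v j i,
      forall j, \sum_i u j i *: a1 i = \sum_i v j i *: a2 i,
      forall j, \sum_i u j i * b1 i = \sum_i v j i * b2 i &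
  forall x,
    (forall j, inner (ratv (\sum_i u j i *: a1 i)) x <= ratr (\sum_i u j i * b1 i)) ->
    exists (y : 'rV[R]_n) (t : R),
      (forall i, inner (ratv (a1 i)) y <= t * ratr (b1 i)) /\
      (forall i, inner (ratv (a2 i)) (x - y) <= (1 - t) * ratr (b2 i))].
Proof.
(* Columns below [n] belong to [y] and column [n] to [t], in the rows [a1 y - t b1 <= 0] and
   [- a2 y + t b2 <= b2 - a2 x]. Annihilating them equates the two combinations of normals and of
   bounds. *)
have [C CE] : exists C : I1 + I2 -> nat -> rat, forall i k, C i k =
    match i, insub k with
    | inl i, Some k => a1 i 0 k | inl i, None => - b1 i
    | inr i, Some k => - a2 i 0 k | inr i, None => b2 i end by eexists.
have [J [W [W0 WC Wsol]]] := @fourier_motzkin R n.+1 (I1 + I2)%type C.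
have Ck i (k : 'I_n) : C i k = match i with inl i => a1 i 0 k | inr i => - a2 i 0 k end.
  by rewrite CE; case: i => i; rewrite valK.
have Cn i : C i n = match i with inl i => - b1 i | inr i => b2 i end.
  by rewrite CE; case: i => i; rewrite insubF// ltnn.
have uva j : \sum_i W j (inl i) *: a1 i = \sum_i W j (inr i) *: a2 i.
  apply/rowP => k; rewrite !summxE; apply/eqP; rewrite -subr_eq0.
  rewrite -[X in _ == X](WC j k); last by rewrite ltnS ltnW.
  rewrite big_sumType/= -sumrN; apply/eqP; congr (_ + _).
    by apply: eq_bigr => i _; rewrite mxE Ck.
  by apply: eq_bigr => i _; rewrite mxE Ck /= mulrN.
have uvb j : \sum_i W j (inl i) * b1 i = \sum_i W j (inr i) * b2 i.
  apply/eqP; rewrite eq_sym -subr_eq0 -[X in _ == X](WC j n)//.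
  rewrite big_sumType/= -sumrN addrC; apply/eqP; congr (_ + _).
    by apply: eq_bigr => i _; rewrite Cn.
  by apply: eq_bigr => i _; rewrite Cn mulrN.
exists J, (fun j i => W j (inl i)), (fun j i => W j (inr i)); split=> // x hx.
pose d (i : I1 + I2) : R := match i with
  | inl _ => 0 | inr i => ratr (b2 i) - inner (ratv (a2 i)) x end.
have [|s hs] := Wsol d.
  move=> j; have := hx j; rewrite uva uvb inner_ratv_sum ratr_sumM -subr_ge0 -sumrB.
  congr (0 <= _); rewrite big_sumType/= [X in _ = X + _]big1 ?add0r; last by move=> i _; rewrite /= mulr0.
  by apply: eq_bigr => i _; rewrite mulrBr.
exists (\row_k s k), (s n); split=> i.
  have := hs (inl i); rewrite big_ord_recr/= Cn /= rmorphN mulNr subr_le0.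
  rewrite mulrC; congr (_ <= _); apply: eq_bigr => k _.
  by rewrite !mxE Ck.
have := hs (inr i); rewrite big_ord_recr/= Cn /= innerBr.
have -> : \sum_(k < n) ratr (C (inr i) k) * s k = - inner (ratv (a2 i)) (\row_k s k).
  by rewrite -sumrN; apply: eq_bigr => k _; rewrite !mxE Ck /= rmorphN mulNr.
lra.
Qed.

Lemma rational_polyhedron_fin (I : finType) (a : I -> 'rV[rat]_n) (b : I -> rat) :
  rational_polyhedron [set x : 'rV[R]_n | forall i, inner (ratv (a i)) x <= ratr (b i)].
Proof.
exists #|I|, (\matrix_(i < #|I|) a (enum_val i)), (b \o enum_val).
apply/seteqP; split=> x /= hx i; first by rewrite rowK.
by have := hx (enum_rank i); rewrite rowK enum_rankK.
Qed.

Lemma rational_polyhedronI P Q :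
  rational_polyhedron P -> rational_polyhedron Q -> rational_polyhedron (P `&` Q).
Proof.
move=> [m1 [A1 [b1 ->]]] [m2 [A2 [b2 ->]]].
have -> : [set x : 'rV[R]_n | forall i, inner (ratv (row i A1)) x <= ratr (b1 i)] `&`
  [set x | forall i, inner (ratv (row i A2)) x <= ratr (b2 i)] =
  [set x | forall i : 'I_m1 + 'I_m2,
     inner (ratv (match i with inl i => row i A1 | inr i => row i A2 end)) x <=
     ratr (match i with inl i => b1 i | inr i => b2 i end)].
  apply/seteqP; split=> x /=; first by move=> [h1 h2] [].
  by move=> h; split=> i; [exact: (h (inl i))|exact: (h (inr i))].
exact: rational_polyhedron_fin.
Qed.

Lemma rational_polyhedron_convex P :
  rational_polyhedron P -> @convex_set R 'rV[R]_n P.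
Proof.
move=> [m [A [b ->]]]; apply/convex_setP => x y t hx hy t0 t1 i.
have /convex_setP := @halfspace_convex R n (ratv (row i A)) (ratr (b i)); apply => //.
  exact: hx.
exact: hy.
Qed.

(** For a rational polyhedron this turns out to be the whole split hull; the explicit end points [p]
    and [q] are what the compactness argument needs. *)
Definition split_segment Q (a : 'rV[int]_n) (K : int) : set 'rV[R]_n :=
  [set x | (Q `&` split_disjunction a K) x \/
    exists p q (t : R), [/\ Q p, Q q, inner (intv a) p <= K%:~R,
      (K + 1)%:~R <= inner (intv a) q &
      [/\ 0 <= t, t <= 1 & x = t *: p + (1 - t) *: q]]].

Lemma split_segment_hull Q a K :
  split_segment Q a K `<=` convex_hull (Q `&` split_disjunction a K).
Proof.
move=> x [|[p [q [t [Qp Qq ap aq [t0 t1 ->]]]]]]; first exact: sub_hull.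
by apply: hull_convex => //; apply: sub_hull; split=> //; [left|right].
Qed.

(** If [z + r] falls strictly inside the strip, the ray is followed up to the parameter [t > 1]
    where it reaches the other side; [z + r] then lies on the segment from [z] to [z + t r]. *)
Lemma split_segment_ray Q a K z r :
  (Q `&` split_disjunction a K) z -> (forall t, 0 <= t -> Q (z + t *: r)) ->
  split_segment Q a K (z + r).
Proof.
move=> [Qz az] Qr.
have Qzr : Q (z + r) by rewrite -[r]scale1r; exact: Qr.
have [az1|az1] := leP (inner (intv a) (z + r)) K%:~R; first by left; split=> //; left.
have [az2|az2] := leP (K + 1)%:~R (inner (intv a) (z + r)).
  by left; split=> //; right.
right; move: az1 az2; rewrite innerDr.
have tE (t : R) : t != 0 -> z + r = t^-1 *: (z + t *: r) + (1 - t^-1) *: z.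
  by move=> t0; apply/rowP => i; rewrite !mxE; field.
case: az => /= az az1 az2.
  have ar : 0 < inner (intv a) r by lra.
  pose t := ((K + 1)%:~R - inner (intv a) z) / inner (intv a) r.
  have t1 : 1 < t by rewrite ltr_pdivlMr//; lra.
  have t0 : 0 < t by lra.
  exists z, (z + t *: r), (1 - t^-1); split=> //.
  - by apply: Qr; exact: ltW.
  - by rewrite innerDr innerZr /t divfK ?lt0r_neq0//; lra.
  - split; first by rewrite subr_ge0 invf_le1// ltW.
      by rewrite gerBl invr_ge0 ltW.
    by rewrite [RHS]addrC subKr; apply: tE; rewrite lt0r_neq0.
have ar : inner (intv a) r < 0 by lra.
pose t := (K%:~R - inner (intv a) z) / inner (intv a) r.
have t1 : 1 < t by rewrite ltr_ndivlMr//; lra.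
have t0 : 0 < t by lra.
exists (z + t *: r), z, t^-1; split=> //.
- by apply: Qr; exact: ltW.
- by rewrite innerDr innerZr /t divfK ?ltr0_neq0//; lra.
- by split; [rewrite invr_ge0 ltW|rewrite invf_le1// ltW|apply: tE; rewrite lt0r_neq0].
Qed.

Lemma split_hull_translate Q a K r :
  (forall z t, 0 <= t -> Q z -> Q (z + t *: r)) ->
  forall x, convex_hull (Q `&` split_disjunction a K) x ->
    convex_hull (Q `&` split_disjunction a K) (x + r).
Proof.
move=> Qr; apply: hull_translate => z Dz.
apply: split_segment_hull; apply: split_segment_ray => // t t0.
by apply: Qr => //; case: Dz.
Qed.

(* The two rational inequalities valid for [Q] that imply [c x <= d] on both
   sides of the split are the certificate that places the split closure above
   the two-halfspace closure. *)
Lemma split_hull_system Q (a : 'rV[int]_n) (K : int) : rational_polyhedron Q ->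
  exists (J : finType) (c : J -> 'rV[rat]_n) (d : J -> rat),
  [/\ forall x, convex_hull (Q `&` split_disjunction a K) x <->
        (forall j, inner (ratv (c j)) x <= ratr (d j)),
      convex_hull (Q `&` split_disjunction a K) `<=` split_segment Q a K &
      forall j, exists (c1 : 'rV[rat]_n) (d1 : rat) (c2 : 'rV[rat]_n) (d2 : rat),
        [/\ Q `<=` halfspace (ratv c1) (ratr d1), Q `<=` halfspace (ratv c2) (ratr d2) &
        halfspace (ratv c1) (ratr d1) `&` halfspace (ratv c2) (ratr d2)
          `&` split_disjunction a K `<=` halfspace (ratv (c j)) (ratr (d j))]].
Proof.
move=> [m [A [b QE]]].
pose ra : 'rV[rat]_n := map_mx intr a.
have raE : ratv ra = intv a by apply/rowP => i; rewrite !mxE ratr_int.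
(* The trivial inequality [0 <= 1] homogenizes to [0 <= t] and [0 <= 1 - t]. *)
pose I := option (option 'I_m).
pose a1 (i : I) : 'rV[rat]_n :=
  match i with None => 0 | Some None => ra | Some (Some i) => row i A end.
pose b1 (i : I) : rat :=
  match i with None => 1 | Some None => K%:~R | Some (Some i) => b i end.
pose a2 (i : I) : 'rV[rat]_n :=
  match i with None => 0 | Some None => - ra | Some (Some i) => row i A end.
pose b2 (i : I) : rat :=
  match i with None => 1 | Some None => - (K + 1)%:~R | Some (Some i) => b i end.
have [J [u [v [u0 v0 uva uvb sol]]]] := union_hull_system a1 b1 a2 b2.
pose c j := \sum_i u j i *: a1 i; pose d j := \sum_i u j i * b1 i.
have R0 (k : rat) : 0 <= k -> 0 <= ratr k :> R by rewrite ler0q.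
have segm x : (forall j, inner (ratv (c j)) x <= ratr (d j)) -> split_segment Q a K x.
  move=> /sol[y [t [h1 h2]]].
  have t0 : 0 <= t by have := h1 None; rewrite /= map_mx0 inner0l rmorph1 mulr1.
  have t1 : t <= 1.
    by have := h2 None; rewrite /= map_mx0 inner0l rmorph1 mulr1 subr_ge0.
  have ay : inner (intv a) y <= t * K%:~R.
    by have := h1 (Some None); rewrite /= raE ratr_int.
  have axy : (1 - t) * (K + 1)%:~R <= inner (intv a) (x - y).
    have := h2 (Some None).
    by rewrite /= map_mxN raE innerNl rmorphN/= ratr_int mulrN lerN2.
  have {}h1 i : inner (ratv (row i A)) y <= t * ratr (b i) by exact: (h1 (Some (Some i))).
  have {}h2 i : inner (ratv (row i A)) (x - y) <= (1 - t) * ratr (b i).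
    exact: (h2 (Some (Some i))).
  (* At [t = 0] the vector [y] is only a recession direction of [Q], starting from the point [x - y]
     of the upper side; at [t = 1] the roles are exchanged. Otherwise rescaling gives the two end
     points. *)
  have [t00|tn0] := eqVneq t 0.
    move: h1 h2 ay axy; rewrite t00 subr0 => h1 h2 ay axy.
    rewrite -(subrK y x); apply: split_segment_ray.
      split; first by rewrite QE => i; have := h2 i; rewrite mul1r.
      by right; rewrite /= -[X in X <= _]mul1r.
    move=> s s0; rewrite QE => i; rewrite innerDr innerZr.
    by have := h1 i; have := h2 i; rewrite mul1r mul0r; nra.
  have [t11|tn1] := eqVneq t 1.
    move: h1 h2 ay axy; rewrite t11 subrr => h1 h2 ay axy.
    have -> : x = y + (x - y) by rewrite addrC subrK.
    apply: split_segment_ray.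
      split; first by rewrite QE => i; have := h1 i; rewrite mul1r.
      by left; rewrite /= -[X in _ <= X]mul1r.
    move=> s s0; rewrite QE => i; rewrite innerDr innerZr.
    by have := h1 i; have := h2 i; rewrite mul1r mul0r; nra.
  have tp : 0 < t by rewrite lt0r tn0.
  have tp1 : 0 < 1 - t by rewrite subr_gt0 lt_neqAle tn1.
  right; exists (t^-1 *: y), ((1 - t)^-1 *: (x - y)), t; split.
  - by rewrite QE => i; rewrite innerZr mulrC ler_pdivrMr// mulrC.
  - by rewrite QE => i; rewrite innerZr mulrC ler_pdivrMr// mulrC.
  - by rewrite innerZr mulrC ler_pdivrMr// mulrC.
  - by rewrite innerZr [leRHS]mulrC ler_pdivlMr// mulrC.
  - split=> //; rewrite !scalerA !mulfV ?lt0r_neq0// !scale1r.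
    by rewrite addrC subrK.
have sumA (k : I -> rat) (aa : I -> 'rV[rat]_n) (bb : I -> rat) x :
    (forall i, 0 <= k i) -> (forall i, inner (ratv (aa i)) x <= ratr (bb i)) ->
    inner (ratv (\sum_i k i *: aa i)) x <= ratr (\sum_i k i * bb i).
  move=> k0 hx; rewrite inner_ratv_sum ratr_sumM; apply: ler_sum => i _.
  by apply: ler_wpM2l => //; exact: R0.
have hull_sys x : convex_hull (Q `&` split_disjunction a K) x ->
    forall j, inner (ratv (c j)) x <= ratr (d j).
  move=> hx j; move: x hx.
  apply: (@hull_min _ _ _ (halfspace (ratv (c j)) (ratr (d j)))).
    exact: halfspace_convex.
  rewrite QE => z [Qz [] az] /=; rewrite /halfspace/= /c /d.
    apply: sumA => // -[[i|]|]/=; [exact: Qz|by rewrite raE ratr_int|].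
    by rewrite map_mx0 inner0l rmorph1.
  rewrite uva uvb; apply: sumA => // -[[i|]|]/=; first exact: Qz.
    by rewrite map_mxN raE innerNl rmorphN/= ratr_int lerN2.
  by rewrite map_mx0 inner0l rmorph1.
exists J, c, d; split.
- by move=> x; split; [exact: hull_sys|move/segm; exact: split_segment_hull].
- by move=> x hx; apply: segm; exact: hull_sys.
move=> j.
have sumI (V : zmodType) (F : I -> V) :
    \sum_i F i = F None + (F (Some None) + \sum_i F (Some (Some i))).
  by rewrite !sum_option.
(* Keeping only the multipliers of the rows of [A] gives inequalities valid for [Q]; adding back the
   split inequality and the trivial one recovers [c j] and [d j], with [u] on the lower side and [v]
   on the upper side. *)
exists (\sum_i u j (Some (Some i)) *: row i A), (\sum_i u j (Some (Some i)) * b i).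
exists (\sum_i v j (Some (Some i)) *: row i A), (\sum_i v j (Some (Some i)) * b i).
have ratrD (k l : rat) : ratr (k + l) = ratr k + ratr l :> R by exact: rmorphD.
have ratrN (k : rat) : ratr (- k) = - ratr k :> R by exact: rmorphN.
have ratrM (k l : rat) : ratr (k * l) = ratr k * ratr l :> R by exact: rmorphM.
have val (k : I -> rat) : (forall i, 0 <= k i) -> Q `<=`
    halfspace (ratv (\sum_i k (Some (Some i)) *: row i A))
      (ratr (\sum_i k (Some (Some i)) * b i)).
  move=> k0 z; rewrite QE => Qz; rewrite /halfspace/= inner_ratv_sum ratr_sumM.
  by apply: ler_sum => i _; apply: ler_wpM2l; [exact: R0|exact: Qz].
split; [exact: val|exact: val|].
move=> z [[h1 h2]]; rewrite /halfspace/= in h1 h2 * => -[] /= az.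
  rewrite /c /d !sumI/= scaler0 add0r mulr1 map_mxD map_mxZ innerDl innerZl raE.
  rewrite !ratrD ratrM ratr_int.
  have := R0 _ (u0 j None); have := R0 _ (u0 j (Some None)); nra.
rewrite /c /d uva uvb !sumI/= scaler0 add0r mulr1 map_mxD map_mxZ innerDl innerZl.
rewrite map_mxN innerNl raE.
rewrite !ratrD !mulrN ratrN ratrM ratr_int.
have := R0 _ (v0 j None); have := R0 _ (v0 j (Some None)); nra.
Qed.

End Balas.

(** * The two-halfspace closure of one rational polyhedron *)

Section TwoInSplit.
Context {R : realType} {n : nat}.
Implicit Types (C P Q X H : set 'rV[R]_n) (x y z r : 'rV[R]_n).
Local Notation intv a := (map_mx intr a : 'rV[R]_n).
Local Notation ratv a := (map_mx ratr a : 'rV[R]_n).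

Lemma two_halfspace_closure_mono P Q :
  P `<=` Q -> two_halfspace_closure P `<=` two_halfspace_closure Q.
Proof.
by move=> PQ x Px H1 H2 r1 r2 QH; apply: Px => //; exact: subset_trans QH.
Qed.

Lemma int_split_disjunction (a : 'rV[int]_n) (K : int) x :
  x \is a mxOver Num.int -> split_disjunction a K x.
Proof.
move=> /mxOverP xint.
have : inner (intv a) x \is a Num.int.
  by apply: rpred_sum => j _; rewrite mxE rpredM ?intr_int.
move=> /intrP[k kE]; rewrite /split_disjunction /= kE !ler_int.
by have [|] := leP k K; [left|right; rewrite lezD1].
Qed.

(** The origin satisfies the disjunction, and the whole space contains every ray, so the hull is
    closed under all translations. *)
Lemma hull_split_disjunction (a : 'rV[int]_n) (K : int) x :
  convex_hull (split_disjunction a K) x.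
Proof.
have := @split_hull_translate R n setT a K x; rewrite setTI => /(_ _ 0).
rewrite add0r; apply=> //; apply: sub_hull; apply: int_split_disjunction.
by apply/mxOverP => i j; rewrite mxE rpred0.
Qed.

(** A coordinate supplies the disjoint halfspaces [x_0 <= 0] and [x_0 >= 1], both of which contain
    the empty set. *)
Lemma two_halfspace_closure_set0 : (0 < n)%N ->
  two_halfspace_closure (set0 : set 'rV[R]_n) `<=` set0.
Proof.
move=> n0 x; pose e : 'rV[rat]_n := delta_mx 0 (Ordinal n0).
have e0 : e != 0.
  by apply/eqP => /rowP/(_ (Ordinal n0))/eqP; rewrite !mxE !eqxx oner_eq0.
pose H (b : bool) : set 'rV[R]_n :=
   halfspace (map_mx ratr ((-1) ^+ b *: e)) (ratr (- b%:R)).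
have rH b : rational_halfspace (H b).
  by eexists; eexists; split; last by []; rewrite scaler_eq0 signr_eq0.
move=> /(_ (H false) (H true) (rH _) (rH _)) hx.
have : integer_hull (H false `&` H true) x by apply: hx.
apply: hull_min; first by apply/convex_setP.
move=> z [[]]; rewrite /H /halfspace /= !map_mxZ !innerZl /= !rmorphN /= !rmorph1 rmorph0; lra.
Qed.

Lemma two_halfspace_closure_sub_split Q : (0 < n)%N -> rational_polyhedron Q ->
  two_halfspace_closure Q `<=` split_closure Q.
Proof.
move=> n0 rQ x Tx a K.
have [Q0|/set0P[q Qq]] := eqVneq Q set0.
  by rewrite Q0 in Tx; have := two_halfspace_closure_set0 n0 Tx.
have [J [c [d [hullE _ cert]]]] := split_hull_system a K rQ.
apply/hullE => j; have [c1 [d1 [c2 [d2 [Q1 Q2 impl]]]]] := cert j.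
have hc : @convex_set R 'rV[R]_n (halfspace (ratv (c j)) (ratr (d j))).
  exact: halfspace_convex.
have triv (c0 : 'rV[rat]_n) d0 z : c0 = 0 ->
    Q `<=` halfspace (ratv c0) (ratr d0) -> halfspace (ratv c0) (ratr d0) z.
  by move=> -> /(_ q Qq); rewrite /halfspace /= map_mx0 !inner0l.
have intD (H1 H2 : set 'rV[R]_n) : rational_halfspace H1 -> rational_halfspace H2 ->
    Q `<=` H1 -> Q `<=` H2 ->
    H1 `&` H2 `<=` halfspace (ratv c1) (ratr d1) `&` halfspace (ratv c2) (ratr d2) ->
    halfspace (ratv (c j)) (ratr (d j)) x.
  move=> r1 r2 QH1 QH2 sub.
  have : integer_hull (H1 `&` H2) x.
    by apply: Tx => // z Qz; split; [exact: QH1|exact: QH2].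
  apply: (hull_min hc) => z [Hz zint]; apply: impl; split; first exact: sub.
  exact: int_split_disjunction.
have rat0 (c0 : 'rV[rat]_n) d0 : c0 != 0 ->
  @rational_halfspace R n (halfspace (ratv c0) (ratr d0)) by exists c0, d0.
(* A certificate with zero normal defines no rational halfspace. As [Q] is nonempty it holds
   everywhere, so the other certificate is used twice; if both are trivial, [c j] is bounded on the
   whole disjunction, hence everywhere. *)
have [c10|c10] := eqVneq c1 0; have [c20|c20] := eqVneq c2 0.
- have := @hull_split_disjunction a K x; apply: (hull_min hc) => z Dz.
  by apply: impl; split=> //; split; exact: triv.
- apply: (intD _ _ (rat0 _ d2 c20) (rat0 _ d2 c20)) => // z [h _].
  by split=> //; exact: triv.
- apply: (intD _ _ (rat0 _ d1 c10) (rat0 _ d1 c10)) => // z [h _].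
  by split=> //; exact: triv.
- exact: (intD _ _ (rat0 _ d1 c10) (rat0 _ d2 c20)).
Qed.

End TwoInSplit.

(** * Limits of rational polyhedra *)

(** The sets meeting [K] form a filter base by directedness; a cluster point of its filter belongs
    to every closed [Z i]. *)
Lemma compact_directed (T : topologicalType) (K : set T) (I : Type) (D : set I)
    (Z : I -> set T) :
  compact K -> D !=set0 -> (forall i, D i -> closed (Z i)) ->
  (forall i, D i -> (K `&` Z i) !=set0) ->
  (forall i j, D i -> D j -> exists2 k, D k & Z k `<=` Z i `&` Z j) ->
  exists w, forall i, D i -> Z i w.
Proof.
move=> cK [i0 Di0] clZ ZK dirZ.
pose F := filter_from D (fun i => K `&` Z i).
have FF : ProperFilter F.
  apply: filter_from_proper => //; apply: filter_from_filter; first by exists i0.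
  move=> i j Di Dj; have [k Dk kij] := dirZ i j Di Dj; exists k => // w [Kw /kij[Zi Zj]].
  by split.
have [|w [_ clw]] := cK F FF; first by exists i0 => // w [].
exists w => i Di; apply: clZ => // B Bw.
have [|v [[_ Zv] Bv]] := clw (K `&` Z i) B _ Bw; first by exists i.
by exists v.
Qed.

Section Limits.
Context {R : realType}.
Local Notation ratv a := (map_mx ratr a : 'rV[R]__).

Lemma closed_halfspace (m : nat) (c : 'rV[R]_m) (b : R) : closed (halfspace c b).
Proof.
rewrite (_ : halfspace c b = inner c @^-1` [set t | t <= b])//.
apply: preimage_closed; last exact: closed_le.
have ic : continuous (inner c).
  apply: continuous_big => [|j _ x].
    by move=> [x y]; apply: cvgD; [exact: cvg_fst|exact: cvg_snd].
  by apply: continuousM; [exact: cst_continuous|exact: coord_continuous].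
by move=> x _; exact: ic.
Qed.

Lemma inner_mulmx (n m : nat) (c : 'rV[R]_n) (w : 'rV[R]_m) (N : 'M[R]_(m, n)) :
  inner c (w *m N) = inner (c *m N^T) w.
Proof.
have inner_mx k (a y : 'rV[R]_k) : inner a y = (a *m y^T) 0 0.
  by rewrite mxE; apply: eq_bigr => j _; rewrite !mxE.
by rewrite !inner_mx trmx_mul mulmxA.
Qed.

Lemma closed_affine_preimage (n m : nat) (Q : set 'rV[R]_n) (x : 'rV[R]_n) (s : R)
    (N : 'M[R]_(m, n)) :
  rational_polyhedron Q -> closed [set w : 'rV[R]_m | Q (x + s *: (w *m N))].
Proof.
move=> [k [A [b ->]]].
rewrite (_ : mkset _ = \bigcap_(i in [set: 'I_k])
    halfspace (s *: (ratv (row i A) *m N^T)) (ratr (b i) - inner (ratv (row i A)) x)).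
  by apply: closed_bigI => i _; exact: closed_halfspace.
apply/seteqP; split=> w /= hw i; last first.
  have := hw i Logic.I; rewrite /halfspace /= innerDr innerZr innerZl inner_mulmx; lra.
by have := hw i; rewrite /halfspace /= innerDr innerZr innerZl inner_mulmx; lra.
Qed.

End Limits.

(** * Split hulls of intersections of rational polyhedra *)

Section Approximation.
Context {R : realType} {n m0 : nat}.
Implicit Types (P Q X H : set 'rV[R]_n) (x y z r : 'rV[R]_n).
Local Notation intv a := (map_mx intr a : 'rV[R]_n).
Local Notation ratv a := (map_mx ratr a : 'rV[R]_n).
Variables (A0 : 'M[rat]_(m0, n)) (b0 : 'I_m0 -> rat).

Let P0 : set 'rV[R]_n := [set x | forall i, inner (ratv (row i A0)) x <= ratr (b0 i)].

(** The last clause keeps the lineality space of [P0], so a direction matters only through its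
    values on the rows of [A0]. *)
Definition approximant Q : Prop :=
  [/\ rational_polyhedron Q, Q `<=` P0 &
   forall z r, Q z -> (forall i, inner (ratv (row i A0)) r = 0) -> Q (z + r)].

Definition approximable X : Prop :=
  X `<=` P0 /\ forall x, (forall Q, approximant Q -> X `<=` Q -> Q x) -> X x.

Lemma approximant_self : approximant P0.
Proof.
split=> //; first by exists m0, A0, b0.
by move=> z r Pz Lr i; rewrite innerDr Lr addr0.
Qed.

Lemma approximantI P Q : approximant P -> approximant Q -> approximant (P `&` Q).
Proof.
move=> [rP P1 P2] [rQ Q1 Q2]; split; first exact: rational_polyhedronI.
  by move=> z [/P1].
by move=> z r [Pz Qz] Lr; split; [exact: P2|exact: Q2].
Qed.

Lemma approximable_self : approximable P0.
Proof. by split=> // x; apply => //; exact: approximant_self. Qed.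

Lemma approximable_convex X : approximable X -> @convex_set R 'rV[R]_n X.
Proof.
move=> [_ aX]; apply/convex_setP => x y t Xx Xy t0 t1; apply: aX => Q aQ XQ.
have [/rational_polyhedron_convex/convex_setP cQ _ _] := aQ.
by apply: cQ => //; exact: XQ.
Qed.

Lemma approximant_split_hull Q (a : 'rV[int]_n) (K : int) : approximant Q ->
  approximant (convex_hull (Q `&` split_disjunction a K)).
Proof.
move=> [rQ QP QL]; split.
- have [J [c [d [hullE _ _]]]] := split_hull_system a K rQ.
  rewrite (_ : convex_hull _ =
    [set x | forall j, inner (ratv (c j)) x <= ratr (d j)]).
    exact: rational_polyhedron_fin.
  by apply/seteqP; split=> x /hullE.
- apply: subset_trans QP; apply: hull_min; first exact: rational_polyhedron_convex.
  by move=> z [].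
- move=> z r hz Lr; apply: split_hull_translate => // {z hz} z t _ Qz.
  by apply: QL => // i; rewrite innerZr Lr mulr0.
Qed.

(* A point of the hull strictly inside the split is [x + r] and [x - s r] combined,
   with [x + r], [x - s r] on the two boundary hyperplanes. Modulo the lineality
   space of [P0] the admissible [r] are confined to a box by the inequalities of
   [P0], so a single [r] serves all approximants. *)
Lemma split_hull_approximable X (a : 'rV[int]_n) (K : int) x : approximable X ->
  (forall Q, approximant Q -> X `<=` Q -> convex_hull (Q `&` split_disjunction a K) x) ->
  convex_hull (X `&` split_disjunction a K) x.
Proof.
move=> [XP aX] hx.
have Qx Q : approximant Q -> X `<=` Q -> Q x.
  move=> aQ XQ; have := hx Q aQ XQ; apply: hull_min; last by move=> z [].
  by case: aQ => /rational_polyhedron_convex.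
have Xx : X x by apply: aX.
have [Dx|Dx] := pselect (split_disjunction a K x); first exact: sub_hull.
have ax1 : K%:~R < inner (intv a) x by rewrite ltNge; apply/negP => h; apply: Dx; left.
have ax2 : inner (intv a) x < (K + 1)%:~R.
  by rewrite ltNge; apply/negP => h; apply: Dx; right.
(* If [a] takes the value [g] on [r], then [x + r] is at level [K] and [x - s r] at level
   [K + 1]. *)
pose s := ((K + 1)%:~R - inner (intv a) x) / (inner (intv a) x - K%:~R).
have s0 : 0 < s by rewrite divr_gt0// subr_gt0.
pose g := K%:~R - inner (intv a) x.
have sg : - s * g = (K + 1)%:~R - inner (intv a) x.
  by rewrite /s /g; field; rewrite lt0r_neq0// subr_gt0.
(* [M] records the values of the rows of [A0] and of [a]; its pseudo-inverse [N] recovers a vector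
   with the same values, thus equal to the original up to the lineality space of [P0]. *)
pose M : 'M[R]_(n, m0 + 1) := row_mx (map_mx ratr A0)^T (intv a)^T.
have Ml r i : (r *m M) 0 (lshift 1 i) = inner (ratv (row i A0)) r.
  by rewrite mul_mx_row row_mxEl mxE; apply: eq_bigr => j _; rewrite !mxE mulrC.
have Mr r : (r *m M) 0 (rshift m0 0) = inner (intv a) r.
  by rewrite mul_mx_row row_mxEr mxE; apply: eq_bigr => j _; rewrite !mxE mulrC.
pose N := pinvmx M.
(* The lower bounds express that [x - s r] lies in [P0], the upper bounds that [x + r] does; the
   last coordinate is fixed to [g]. *)
pose lo : 'rV[R]_(m0 + 1) := row_mx
  (\row_i ((inner (ratv (row i A0)) x - ratr (b0 i)) / s)) (const_mx g).
pose hi : 'rV[R]_(m0 + 1) := row_mx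
  (\row_i (ratr (b0 i) - inner (ratv (row i A0)) x)) (const_mx g).
pose box := [set w : 'rV[R]_(m0 + 1) | forall i, `[lo 0 i, hi 0 i]%classic (w ord0 i)].
pose Z Q := [set w : 'rV[R]_(m0 + 1) | Q (x + 1 *: (w *m N))] `&`
  [set w | Q (x + (- s) *: (w *m N))] `&`
  [set w | inner (intv a) (w *m N) = g].
have [|||||w hw] := @compact_directed _ box _ [set Q | approximant Q /\ X `<=` Q] Z.
- by apply: (@rV_compact R _ (fun i => `[lo 0 i, hi 0 i]%classic)) => i; exact: segment_compact.
- by exists P0; split=> //; exact: approximant_self.
- move=> Q [[rQ _ _] _]; apply: closedI; first by apply: closedI; exact: closed_affine_preimage.
  rewrite (_ : mkset _ = halfspace (intv a *m N^T) g `&` halfspace (- (intv a *m N^T)) (- g)).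
    by apply: closedI; exact: closed_halfspace.
  apply/seteqP; split=> w; rewrite /halfspace /= innerNl lerN2 inner_mulmx.
    by move=> ->.
  by move=> [h1 h2]; apply/eqP; rewrite eq_le h1.
- move=> Q [aQ XQ]; have [rQ QP QL] := aQ.
  have [r [Qr1 Qr2 ar]] : exists r, [/\ Q (x + r), Q (x - s *: r) & inner (intv a) r = g].
    have cQ := rational_polyhedron_convex rQ; move/convex_setP in cQ.
    have [J [c [d [_ segm _]]]] := split_hull_system a K rQ.
    have [[_ //]|[p [q [t [Qp Qq ap aq [t0 t1 xE]]]]]] := segm x (hx Q aQ XQ).
    pose v := p - q.
    have av : inner (intv a) v < 0 by rewrite innerBr; lra.
    have qx : x = q + t *: v by rewrite xE /v; apply/rowP => i; rewrite !mxE; ring.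
    (* The levels of [p] and [q] enclose the strip, so the part of their line inside the strip
       belongs to the segment. *)
    have onseg (k : R) : K%:~R <= inner (intv a) x + k * inner (intv a) v <= (K + 1)%:~R ->
        Q (x + k *: v).
      move=> /andP[k1 k2].
      have axE : inner (intv a) x = inner (intv a) q + t * inner (intv a) v.
        by rewrite {1}qx innerDr innerZr.
      have apE : inner (intv a) p = inner (intv a) q + inner (intv a) v.
        by rewrite /v innerBr; ring.
      have -> : x + k *: v = (t + k) *: p + (1 - (t + k)) *: q.
        by rewrite qx /v; apply/rowP => i; rewrite !mxE; ring.
      apply: cQ => //; nra.
    exists ((g / inner (intv a) v) *: v); split.
    - apply: onseg; rewrite divfK ?ltr0_neq0// /g; lra.
    - rewrite -scaleNr scalerA; apply: onseg.
      by rewrite mulrA mulfVK ?ltr0_neq0// sg; lra.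
    - by rewrite innerZr divfK// ltr0_neq0.
  pose w := r *m M.
  have wNM : w *m N *m M = w by apply: mulmxKpV; exact: submxMl.
  have Lw i : inner (ratv (row i A0)) (w *m N - r) = 0.
    by rewrite -Ml mulmxBl wNM subrr mxE.
  have aw : inner (intv a) (w *m N) = g by rewrite -Mr wNM Mr.
  have Qw (k : R) : Q (x + k *: r) -> Q (x + k *: (w *m N)).
    move=> Qk; have -> : x + k *: (w *m N) = x + k *: r + k *: (w *m N - r).
      by rewrite scalerBr [k *: _ - _]addrC addrA addrK.
    by apply: QL => // i; rewrite innerZr Lw mulr0.
  exists w; split; last first.
    split=> //; split=> /=; first by apply: Qw; rewrite scale1r.
    by apply: Qw; rewrite scaleNr.
  move=> i; rewrite /= in_itv /=; case: (split_ordP i) => k ->.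
    have -> : w ord0 (lshift 1 k) = inner (ratv (row k A0)) r by exact: Ml.
    rewrite !row_mxEl !mxE.
    have := QP _ Qr1 k; have := QP _ Qr2 k; rewrite !innerDr innerNr innerZr => h1 h2.
    by rewrite ler_pdivrMr//; lra.
  rewrite ord1; have -> : w ord0 (rshift m0 0) = inner (intv a) r by exact: Mr.
  by rewrite !row_mxEr !mxE ar lexx.
- move=> P Q [aP XP'] [aQ XQ]; exists (P `&` Q).
    split; first exact: approximantI.
    by move=> z Xz; split; [exact: XP'|exact: XQ].
  by move=> w [[[h1 h2] [h3 h4]] h5].
have [_ aw] := hw P0 (conj approximant_self XP).
have X1 : X (x + 1 *: (w *m N)) by apply: aX => Q aQ XQ; have [[]] := hw Q (conj aQ XQ).
have X2 : X (x - s *: (w *m N)).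
  by rewrite -scaleNr; apply: aX => Q aQ XQ; have [[]] := hw Q (conj aQ XQ).
apply: (@hull_between _ _ _ _ (w *m N) s 1 (ltW s0) ler01).
  apply: sub_hull; split=> //; right.
  by rewrite /= innerBr innerZr aw -mulNr sg; lra.
apply: sub_hull; split=> //; left.
by rewrite /= innerDr innerZr aw /g; lra.
Qed.

(** For each split and each approximant [Q] of [X], the split hull of [Q] is an approximant of
    [split_closure X]; [split_hull_approximable] then passes to the limit over [Q]. *)
Lemma approximable_split_closure X : approximable X -> approximable (split_closure X).
Proof.
move=> aX; have [XP _] := aX; split.
  by apply: subset_trans XP; apply: split_closure_sub; exact: approximable_convex.
move=> x hx a K; apply: split_hull_approximable => // Q aQ XQ.
apply: hx; first exact: approximant_split_hull.
by move=> z /(_ a K); apply: hull_mono => y [/XQ].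
Qed.

(** The inclusion holds for each approximant and passes to the limit one split at a time. *)
Lemma two_halfspace_closure_sub_split_approximable X : (0 < n)%N -> approximable X ->
  two_halfspace_closure X `<=` split_closure X.
Proof.
move=> n0 aX x Tx a K; apply: split_hull_approximable => // Q aQ XQ.
have [rQ _ _] := aQ.
apply: two_halfspace_closure_sub_split => //.
exact: two_halfspace_closure_mono Tx.
Qed.

Lemma approximable_iter_split_closure k : approximable (iter k split_closure P0).
Proof.
elim: k => [|k IH]; first exact: approximable_self.
exact: approximable_split_closure.
Qed.

End Approximation.

(** * Iterated closures and ranks *)

Section Ranks.
Context {R : realType} {n : nat}.
Implicit Types (P Q X : set 'rV[R]_n) (cl : set 'rV[R]_n -> set 'rV[R]_n).

Lemma iter_two_halfspace_closure_sub P k : (0 < n)%N -> rational_polyhedron P ->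
  iter k two_halfspace_closure P `<=` iter k split_closure P.
Proof.
move=> n0 [m [A [b ->]]]; elim: k => [//|k IH].
apply: (subset_trans (two_halfspace_closure_mono IH)).
apply: two_halfspace_closure_sub_split_approximable => //.
exact: approximable_iter_split_closure.
Qed.

Lemma iter_split_closure_sub P k :
  iter (2 * k) split_closure P `<=` iter k two_halfspace_closure P.
Proof.
elim: k => [|k IH]; first by rewrite muln0.
rewrite mulnS iterD /=.
apply: (@subset_trans _ (split_closure (split_closure (iter k two_halfspace_closure P))));
  last exact: split_closure_twice_sub.
by apply: split_closure_mono; exact: split_closure_mono.
Qed.

Lemma integer_hull_sub_two_halfspace_closure X :
  integer_hull X `<=` two_halfspace_closure X.
Proof.
move=> x hx H1 H2 _ _ XH; apply: hull_mono hx => z [Xz zint].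
by split=> //; exact: XH.
Qed.

Lemma integer_hull_sub_split_closure X : integer_hull X `<=` split_closure X.
Proof.
move=> x hx a K; apply: hull_mono hx => z [Xz zint].
by split=> //; exact: int_split_disjunction.
Qed.

Lemma integer_hull_sub_iter cl P k : @convex_set R 'rV[R]_n P ->
  (forall X, integer_hull X `<=` cl X) -> integer_hull P `<=` iter k cl P.
Proof.
move=> cP hcl; elim: k => [|k IH]; first by apply: hull_min => // z [].
apply: subset_trans (hcl _); apply: hull_mono => z [Pz zint]; split=> //.
by apply: IH; exact: sub_hull.
Qed.

(** This covers both rank bounds, with [f] doubling and [c] one half, or [f] the identity and
    [c = 1]. If [cl1] never reaches the integer hull, the right-hand side is infinite. *)
Lemma closure_rank_le cl1 cl2 P (f : nat -> nat) (c : R) : 0 < c ->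
  (forall k, c * (f k)%:R <= k%:R) ->
  (forall k, iter k cl1 P = integer_hull P -> iter (f k) cl2 P = integer_hull P) ->
  (c%:E * closure_rank cl2 P <= closure_rank cl1 P)%E.
Proof.
move=> c0 fk h; rewrite /closure_rank.
case: (pselect (exists k, `[< iter k cl1 P = _ >])) => [ex1|_]; last by rewrite leey.
case: (ex_minnP ex1) => k /asboolP/h/asboolP fk1 _.
case: pselect => [ex2|[]]; last by exists (f k).
case: (ex_minnP ex2) => l _ /(_ _ fk1) lk.
rewrite -EFinM lee_fin; apply: le_trans (fk k).
by rewrite ler_pM2l// ler_nat.
Qed.

End Ranks.

Theorem corollary1p4 (R : realType) (n : nat) (hn : (0 < n)%N)
    (P : set 'rV[R]_n) (hP : rational_polyhedron P) :
  (forall k : nat,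
     iter (2 * k) split_closure P `<=` iter k two_halfspace_closure P /\
     iter k two_halfspace_closure P `<=` iter k split_closure P) /\
  ((2^-1)%:E * closure_rank split_closure P
     <= closure_rank two_halfspace_closure P)%E /\
  (closure_rank two_halfspace_closure P <= closure_rank split_closure P)%E.
Proof.
have ST k := @iter_split_closure_sub R n P k.
have TS k := iter_two_halfspace_closure_sub (k := k) hn hP.
have cP := rational_polyhedron_convex hP.
split; first by move=> k; split; [exact: ST|exact: TS].
(* Every iterate of either closure contains the integer hull, so an iterate contained in it equals
   it. *)
split.
  apply: (@closure_rank_le _ _ _ _ _ (muln 2)) => [|k|k Tk].
  - by rewrite invr_gt0.
  - by rewrite natrM mulKf// pnatr_eq0.
  - apply/seteqP; split; first by rewrite -Tk; exact: ST.
    exact: integer_hull_sub_iter cP (@integer_hull_sub_split_closure R n).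
rewrite -[X in (X <= _)%E]mul1e.
apply: (@closure_rank_le _ _ _ _ _ id) => [//|k|k Sk]; first by rewrite mul1r.
apply/seteqP; split; first by rewrite -Sk; exact: TS.
exact: integer_hull_sub_iter cP (@integer_hull_sub_two_halfspace_closure R n).
Qed.
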